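(* Let $A=\langle a_1,a_2\mid \Pi(a_1,a_2,m_A)=\Pi(a_2,a_1,m_A)\rangle$ and $B=\langle b_1,b_2\mid \Pi(b_1,b_2,m_B)=\Pi(b_2,b_1,m_B)\rangle$ be dihedral Artin groups, with $m_A,m_B\in\{2,3,4,\dots\}\cup\{\infty\}$ (no relation when the label is $\infty$), and let $\varphi:A\to B$ be a homomorphism with $\varphi(a_1)=b_1$. Then: (1) If $m_A=\infty$, then $\varphi(a_2)$ can take any value in $B$. (2) If $m_A$ is odd and $m_B$ is even or $\infty$, then $\varphi(a_2)=b_1$. (3) If $m_A$ and $m_B$ are odd, then either $\varphi(a_2)=b_1$, or $m_B$ divides $m_A$ and there exists $t\in\mathbb{Z}$ with $\varphi(a_2)=b_1^t b_2 b_1^{-t}$. (4) If $m_A$ is even and $m_B=\infty$, then there exists $t\in\mathbb{Z}$ with $\varphi(a_2)=b_1^t$. (5) If $m_A$ is even and $m_B$ is odd, then one of the following holds: there exist $t_1,t_2\in\mathbb{Z}$ with $\varphi(a_2)=\delta_B^{t_1}b_1^{t_2}$; or $4$ divides $m_A$ and there exist $\beta\in B$, $t\in\mathbb{Z}$ with $\varphi(a_2)=b_1^{-1}\beta\Delta_B^t\beta^{-1}$; or there exist $\beta\in B$, $t\in\mathbb{Z}$ with $\varphi(a_2)=b_1^{-1}\beta u_B^t\beta^{-1}$ and, setting $p=\gcd(t,m_B)$ and $q=m_B/p$, $q$ divides $m_A/2$. (6) If $m_A$ and $m_B$ are even and $m_B\neq 2$, then one of the following holds: there exist $t_1,t_2\in\mathbb{Z}$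 with $\varphi(a_2)=\delta_B^{t_1}b_1^{t_2}$; or there exist $\beta\in B$, $t\in\mathbb{Z}$ with $\varphi(a_2)=b_1^{-1}\beta u_B^t\beta^{-1}$ and, setting $p=\gcd(t,m_B/2)$ and $q=m_B/(2p)$, $q$ divides $m_A/2$. (7) If $m_A$ is even and $m_B=2$, then $\varphi(a_2)$ can be any element of $B$.
   Context: $\Pi(s,t,m)$ denotes the alternating word $sts\cdots$ of length $m$. For a dihedral Artin group $B=\langle b_1,b_2\mid \Pi(b_1,b_2,m_B)=\Pi(b_2,b_1,m_B)\rangle$ with $m_B$ finite: the Garside element is $\Delta_B=\Pi(b_1,b_2,m_B)=\Pi(b_2,b_1,m_B)$; $\delta_B=\Delta_B^2$ if $m_B$ is odd and $\delta_B=\Delta_B$ if $m_B$ is even (for $m_B\ge3$, $\delta_B$ generates the center of $B$); and $u_B=b_1b_2$. Statements ''can take any value'' mean that every element of $B$ occurs as $\varphi(a_2)$ for some such homomorphism $\varphi$. *)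

(* Defs.v *)
(* Dihedral Artin groups modelled as words in the two
   generators and their inverses, modulo the congruence generated by free
   cancellation and the Artin relation. *)
From mathcomp Require Import all_boot all_order all_algebra.
Set Implicit Arguments. Unset Strict Implicit. Unset Printing Implicit Defensive.

(* A letter: (generator, inverted?).  generator false = x_1, true = x_2. *)
Definition letter := (bool * bool)%type.
Definition word := seq letter.

Definition linv (x : letter) : letter := (x.1, ~~ x.2).
Definition winv (w : word) : word := rev (map linv w).

Fixpoint Pi (s t : letter) (n : nat) : word :=
  match n with 0 => [::] | n'.+1 => s :: Pi t s n' end.

Definition g1 : letter := (false, false).
Definition g2 : letter := (true, false).

(* generators as words: a_i in A and b_i in B are both [:: g_i] *)
Definition x1 : word := [:: g1].
Definition x2 : word := [:: g2].

(* labels: None = infinity, Some m = m (must be >= 2) *)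
Definition valid_label (m : option nat) : Prop :=
  match m with None => True | Some k => 2 <= k end.

Inductive weq (m : option nat) : word -> word -> Prop :=
| weq_refl u : weq m u u
| weq_sym u v : weq m u v -> weq m v u
| weq_trans u v w : weq m u v -> weq m v w -> weq m u w
| weq_cancel u v x : weq m (u ++ x :: linv x :: v) (u ++ v)
| weq_rel u v k : m = Some k -> weq m (u ++ Pi g1 g2 k ++ v) (u ++ Pi g2 g1 k ++ v).

Definition wpow (w : word) (t : int) : word :=
  match t with
  | Posz n => flatten (nseq n w)
  | Negz n => flatten (nseq n.+1 (winv w))
  end.

(* group homomorphism A -> B, given as a map on representatives *)
Definition is_hom (mA mB : option nat) (f : word -> word) : Prop :=
  (forall u v, weq mA u v -> weq mB (f u) (f v)) /\
  (forall u v, weq mB (f (u ++ v)) (f u ++ f v)).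

Definition Garside (k : nat) : word := Pi g1 g2 k.
Definition deltaB (k : nat) : word := if odd k then Garside k ++ Garside k else Garside k.
Definition uB : word := [:: g1; g2].

(* Main.v *)
From HB Require Import structures.
Require Import Defs.
From mathcomp Require Import all_boot all_order all_algebra.
From mathcomp Require Import zify boolp.

(** Modulo the central subgroup generated by [delta_B], a dihedral Artin group
    is a free product of two cyclic groups: [Z/2 * Z/m] generated by [Delta_B]
    and [u_B] for [m] odd, [Z * Z/(m/2)] generated by [b_1] and [u_B] for [m]
    even, and [Z * Z] for [m] infinite.  Put [w = b_1 phi(a_2)].  The relation
    of [A] makes a positive power of [w] commute with [b_1].  In a free product
    of cyclic groups the centralizer of a nontrivial power of [b_1] is [<b_1>],
    and a torsion element is conjugate into a free factor; so in the quotient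
    either [w] is a power of [b_1], or [w] is conjugate to a power of one of
    the two generators, of bounded order.  The length homomorphism to [Z] is
    injective on [<delta_B>], hence detects what is lost in the quotient.  When
    both labels are odd, the Garside element of [A] maps to an involution, which
    forces the conjugator to be a power of [b_1] times a power of [u_B]. *)

Set Implicit Arguments.
Unset Strict Implicit.
Unset Printing Implicit Defensive.
Import Order.TTheory GRing.Theory Num.Theory.

(** * Free products of two cyclic groups *)

Section FreeProduct.
(* [p b] is the order of the factor [b], with [0] for an infinite factor, in
   agreement with [(i %% 0)%Z = i]. *)
Variable p : bool -> nat.

Implicit Types (x y : bool * int) (s t r : seq (bool * int)) (i j : int).

(** Exponents are stored as nonzero canonical residues, so a normal form is literally a list and
    group equality is equality of lists. *)
Definition cansyl x := (x.2 != 0%R) && (x.2 == (x.2 %% p x.1)%Z).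
Definition altsyl x y := x.1 != y.1.
Definition reduced s := all cansyl s && sorted altsyl s.

Definition consyl b i s :=
  if (i %% p b)%Z == 0%R then s else (b, (i %% p b)%Z) :: s.

(** Van der Waerden's device: a syllable acts on normal forms from the left. Multiplication of
    reduced words is the iterated action, and associativity follows from its compatibility with
    addition of exponents. *)
Definition mulsyl x s :=
  match s with
  | y :: s' => if x.1 == y.1 then consyl x.1 (x.2 + y.2)%R s'
               else consyl x.1 x.2 s
  | [::] => consyl x.1 x.2 [::]
  end.

Definition mulred s t := foldr mulsyl t s.
Definition oppsyl x : bool * int := (x.1, (- x.2 %% p x.1)%Z).
Definition invred s := rev (map oppsyl s).

Lemma reduced_cons x s :
  reduced (x :: s) = [&& cansyl x, reduced s &
                         if s is y :: _ then x.1 != y.1 else true].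
Proof.
rewrite /reduced; case: s => [|y s] /=; first by rewrite !andbT.
by rewrite -!andbA; do !bool_congr.
Qed.

Lemma reduced_behead x s : reduced (x :: s) -> reduced s.
Proof. by rewrite reduced_cons => /and3P[]. Qed.

Lemma consyl_reduced b i s :
  reduced s -> (if s is y :: _ then b != y.1 else true) ->
  reduced (consyl b i s).
Proof.
rewrite /consyl; case: ifPn => // nz rs hd.
by rewrite reduced_cons rs hd /cansyl /= nz modz_mod eqxx.
Qed.

Lemma mulsyl_reduced x s : reduced s -> reduced (mulsyl x s).
Proof.
case: s => [|y s] rs /=; first exact: consyl_reduced.
move: (rs); rewrite reduced_cons => /and3P[cy rs' hd].
case: eqP => [exy|/eqP nxy]; last exact: consyl_reduced.
by apply: consyl_reduced => //; rewrite exy.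
Qed.

Lemma mulred_reduced s t : reduced t -> reduced (mulred s t).
Proof. by move=> rt; elim: s => //= x s; apply: mulsyl_reduced. Qed.

Lemma mulsyl_cons x s : reduced (x :: s) -> mulsyl x s = x :: s.
Proof.
case: x => b i; rewrite reduced_cons /cansyl /= => /and3P[/andP[nz /eqP e] rs hd].
have ec t : consyl b i t = (b, i) :: t by rewrite /consyl -e (negbTE nz).
by case: s hd rs => [|y s] /= => [_|/negbTE->] _; rewrite ec.
Qed.

Lemma mulred_cat s t : reduced (s ++ t) -> mulred s t = s ++ t.
Proof.
elim: s => //= x s IH rxs.
by rewrite IH ?mulsyl_cons //; apply: reduced_behead rxs.
Qed.

Lemma mulsyl_consyl b i j s :
  reduced s -> (if s is y :: _ then b != y.1 else true) ->
  mulsyl (b, i) (consyl b j s) = consyl b (i + j)%R s.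
Proof.
move=> rs hd; rewrite {1}/consyl; case: eqP => [ej|_] /=.
  have -> : consyl b (i + j) s = consyl b i s.
    by rewrite /consyl -modzDmr ej addr0.
  by case: s rs hd => //= y s _ /negbTE->.
by rewrite eqxx /consyl modzDmr.
Qed.

Lemma mulsylD b i j s : reduced s ->
  mulsyl (b, i) (mulsyl (b, j) s) = mulsyl (b, i + j)%R s.
Proof.
case: s => [|y s] rs /=; first exact: mulsyl_consyl.
move: (rs); rewrite reduced_cons => /and3P[cy rs' hd].
case: eqP => [exy|/eqP nxy]; last exact: mulsyl_consyl.
by rewrite mulsyl_consyl ?exy // addrA.
Qed.

Lemma mulsyl0 b i s : reduced s -> (i %% p b)%Z = 0%R -> mulsyl (b, i) s = s.
Proof.
case: s => [|y s] rs i0 /=; first by rewrite /consyl i0.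
case: eqP => [exy|/eqP nxy]; last by rewrite /consyl i0.
move: rs; rewrite reduced_cons /cansyl => /and3P[/andP[nz /eqP ey] rs hd].
rewrite /consyl -modzDml i0 add0r exy -ey (negbTE nz).
by case: y {exy nz hd ey}.
Qed.

Lemma mulred_consyl b i s t : reduced t ->
  mulred (consyl b i s) t = mulsyl (b, i) (mulred s t).
Proof.
move=> rt; have rst := mulred_reduced s rt.
rewrite /consyl; case: eqP => [i0|_] /=; first by rewrite mulsyl0.
(* The inserted syllable has exponent divisible by [p b] and acts trivially; added to the residue it
   restores [i]. *)
have -> : mulsyl (b, (i %% p b)%Z) (mulred s t) =
    mulsyl (b, (i %% p b)%Z) (mulsyl (b, (i - (i %% p b)%Z)%R) (mulred s t)).
  rewrite (@mulsyl0 b (i - (i %% p b)%Z)%R) //.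
  by rewrite -modzDmr modzNm modzDmr subrr mod0z.
by rewrite mulsylD // subrKC.
Qed.

Lemma mulred_mulsyl x s t : reduced s -> reduced t ->
  mulred (mulsyl x s) t = mulsyl x (mulred s t).
Proof.
move=> rs rt; case: x => b i.
case: s rs => [|[c j] s] rs /=; first by rewrite mulred_consyl.
case: eqP => [->|_]; last by rewrite mulred_consyl.
by rewrite mulred_consyl // mulsylD //; apply: mulred_reduced.
Qed.

Lemma mulredA s t r : reduced t -> reduced r ->
  mulred (mulred s t) r = mulred s (mulred t r).
Proof.
move=> rt rr; elim: s => //= x s IH.
by rewrite mulred_mulsyl ?IH //; apply: mulred_reduced.
Qed.

Lemma cansyl_opp x : cansyl x -> cansyl (oppsyl x).
Proof.
case: x => b i; rewrite /cansyl /= => /andP[nz /eqP e].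
rewrite modz_mod eqxx andbT; apply: contra nz => /eqP h.
by rewrite e -(opprK i) -modzNm h oppr0 mod0z.
Qed.

Lemma invred_reduced s : reduced s -> reduced (invred s).
Proof.
rewrite /reduced /invred => /andP[hc hs]; apply/andP; split.
  rewrite all_rev all_map; apply: sub_all hc => x; exact: cansyl_opp.
rewrite rev_sorted sorted_map; apply: sub_sorted hs => x y.
by rewrite /altsyl /= eq_sym.
Qed.

Lemma invredV s t : reduced s -> reduced t -> mulred (invred s) (mulred s t) = t.
Proof.
rewrite /invred; elim: s t => //= -[b i] s IH t rs rt.
rewrite rev_cons /mulred -cats1 foldr_cat /= -/(mulred s t).
rewrite -/(mulred _ _) mulsylD ?mulred_reduced // mulsyl0 ?mulred_reduced //.
  exact/IH/rt/(reduced_behead rs).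
by rewrite modzDml addNr mod0z.
Qed.

Lemma oppsylK x : cansyl x -> oppsyl (oppsyl x) = x.
Proof.
case: x => b i; rewrite /cansyl /oppsyl /= => /andP[_ /eqP e].
by rewrite modzNm opprK -e.
Qed.

Lemma invredK s : reduced s -> invred (invred s) = s.
Proof.
rewrite /invred => /andP[hc _]; rewrite map_rev revK -map_comp.
by apply: map_id_in => x /(allP hc) /oppsylK.
Qed.

Lemma size_mulsyl x s : size (mulsyl x s) <= (size s).+1.
Proof.
have hc b i t : size (consyl b i t) <= (size t).+1.
  by rewrite /consyl; case: ifP => /= _; rewrite ?leqnSn.
case: s => [|y s] /=; first exact: hc.
by case: eqP => _; rewrite ?hc // leqW.
Qed.

Lemma reduced_cons_size x s : cansyl x -> reduced s ->
  size (mulsyl x s) = (size s).+1 -> reduced (x :: s).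
Proof.
move=> cx rs; rewrite reduced_cons cx rs /=.
case: s rs => [|y s] rs //=; case: eqP => //= _.
rewrite /consyl; case: ifP => _ /= /eqP; rewrite ?eqSS; first by rewrite ltn_eqF.
by rewrite ltn_eqF.
Qed.

Lemma size_mulred s t : size (mulred s t) <= size s + size t.
Proof.
by elim: s => //= x s IH; apply: leq_trans (size_mulsyl _ _) _; rewrite addSn ltnS.
Qed.

(** Each syllable adds at most one to the length, so full length leaves no room for a merge or a
    cancellation at any stage. *)
Lemma reduced_size s t : all cansyl s -> reduced t ->
  size (mulred s t) = size s + size t -> reduced (s ++ t).
Proof.
elim: s => //= x s IH /andP[cx cs] rt hs.
have le := size_mulsyl x (mulred s t); have le' := size_mulred s t.
have e : size (mulred s t) = size s + size t by lia.
have rst := IH cs rt e; have er := mulred_cat rst.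
by apply: reduced_cons_size => //; rewrite -er hs er size_cat addSn.
Qed.

Lemma reduced_cat x s y t :
  reduced ((x :: s) ++ y :: t) =
  [&& reduced (x :: s), (last x s).1 != y.1 & reduced (y :: t)].
Proof.
rewrite /reduced all_cat /= cat_path /=.
by rewrite -!andbA; do !bool_congr.
Qed.

Definition freeprod := {s | reduced s}.
HB.instance Definition _ := SubChoice.copy freeprod {s | reduced s}.

Definition fpone : freeprod := exist _ [::] isT.
Definition fpmul (g h : freeprod) : freeprod :=
  exist _ (mulred (val g) (val h)) (mulred_reduced (val g) (valP h)).
Definition fpinv (g : freeprod) : freeprod :=
  exist _ (invred (val g)) (invred_reduced (valP g)).

Lemma fpmulA : associative fpmul.
Proof. by move=> g h k; apply: val_inj; rewrite /= mulredA ?valP. Qed.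
Lemma fpmul1 : left_id fpone fpmul.
Proof. by move=> g; apply: val_inj. Qed.
Lemma fpmulr1 : right_id fpone fpmul.
Proof. by move=> g; apply: val_inj; rewrite /= mulred_cat ?cats0 // valP. Qed.
Lemma fpmulV : left_inverse fpone fpinv fpmul.
Proof.
move=> g; apply: val_inj => /=.
rewrite -{2}[val g]cats0 -mulred_cat ?cats0 ?valP //.
by rewrite invredV ?valP.
Qed.
Lemma fpmulrV : right_inverse fpone fpinv fpmul.
Proof.
move=> g; rewrite -{1}[g](_ : fpinv (fpinv g) = g) ?fpmulV //.
by apply: val_inj; rewrite /= invredK ?valP.
Qed.

HB.instance Definition _ :=
  isGroup.Build freeprod fpmulA fpmul1 fpmulr1 fpmulV fpmulrV.

End FreeProduct.

Local Open Scope group_scope.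

(** * Integer powers and conjugation in a group *)

Section IntegerPowers.
Variable G : groupType.
Implicit Types (g h : G) (i j : int).

Definition zpow g i : G :=
  match i with Posz n => g ^+ n | Negz n => g^-1 ^+ n.+1 end.

Lemma zpow1D g i : zpow g (1 + i)%R = g * zpow g i.
Proof.
case: i => [n|[|n]]; first by rewrite /= -expgS.
  by rewrite /= mulgV.
have -> : (1 + Negz n.+1)%R = Negz n by lia.
rewrite /zpow.
by rewrite (expgS g^-1 n.+1) mulgA mulgV mul1g.
Qed.

Lemma zpowD g i j : zpow g (i + j)%R = zpow g i * zpow g j.
Proof.
elim/int_rect: i => [|n IH|n IH]; first by rewrite add0r mul1g.
  have -> : (n.+1%:Z + j)%R = (1 + (n%:Z + j))%R by lia.
  have -> : Posz n.+1 = (1 + n%:Z)%R by lia.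
  by rewrite !zpow1D IH mulgA.
apply: (mulgI g); rewrite mulgA -!zpow1D.
have -> : (1 + (- n.+1%:Z + j))%R = (- n%:Z + j)%R by lia.
by have -> : (1 - n.+1%:Z)%R = (- n%:Z)%R by lia.
Qed.

Lemma zpowN g i : zpow g (- i)%R = (zpow g i)^-1.
Proof. by apply/esym/mulg1_eq; rewrite -zpowD subrr. Qed.

Lemma commute_zpow g h i : commute g h -> commute g (zpow h i).
Proof.
by move=> c; case: i => n /=; apply: commuteX => //; apply: commuteV.
Qed.

Lemma zpowM g i j : zpow g (i * j)%R = zpow (zpow g i) j.
Proof.
elim/int_rect: j => [|n IH|n IH]; first by rewrite mulr0.
  by rewrite intS mulrDr mulr1 !zpowD IH.
by rewrite intS opprD mulrDr mulrN1 !zpowD IH !zpowN.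
Qed.

Lemma zpow_conj g h i : zpow (h * g * h^-1) i = h * zpow g i * h^-1.
Proof.
have e x n : (h * x * h^-1) ^+ n = h * x ^+ n * h^-1.
  elim: n => [|n IH]; first by rewrite mulg1 mulgV.
  by rewrite !expgS IH !mulgA mulgVK.
by case: i => n /=; rewrite -e // !invgM invgK mulgA.
Qed.

(** Stripping [b] from the left of the conjugator changes the product of a conjugate of [a] with [b]
    only by conjugation, hence keeps its order. *)
Lemma conj_mul_shift (b g a : G) :
  b^-1 * (b * g * a * (b * g)^-1 * b) * b = g * a * g^-1 * b.
Proof. by rewrite invgM !mulgA mulVg mul1g mulgVK. Qed.

Lemma conj_mul_shiftV (b g a : G) :
  b * (b^-1 * g * a * (b^-1 * g)^-1 * b) * b^-1 = g * a * g^-1 * b.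
Proof. by rewrite invgM invgK !mulgA mulgV mul1g mulgK. Qed.

End IntegerPowers.

(** * Torsion and centralizers in a free product of two cyclic groups *)

Section FreeProductTheory.
Variable p : bool -> nat.
Local Notation G := (freeprod p).
Implicit Types (x y : bool * int) (s t : seq (bool * int)) (i j : int) (g h : G).

Definition syl b i : G :=
  exist _ (mulsyl p (b, i) [::]) (@mulsyl_reduced p (b, i) [::] isT).
Definition fpmk s : G := foldr (fun x g => syl x.1 x.2 * g) 1 s.

Lemma val_fpmk s : val (fpmk s) = mulred p s [::].
Proof.
elim: s => //= -[b i] s IH.
by rewrite mulred_consyl ?valP // IH.
Qed.

Lemma fpmk_cat s t : fpmk (s ++ t) = fpmk s * fpmk t.
Proof. by elim: s => [|x s IH] /=; rewrite ?mul1g // IH mulgA. Qed.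

Lemma val_fpmk_reduced s : reduced p s -> val (fpmk s) = s.
Proof. by move=> rs; rewrite val_fpmk mulred_cat ?cats0. Qed.

Lemma fpmk_val g : fpmk (val g) = g.
Proof. by apply: val_inj; rewrite val_fpmk_reduced ?valP. Qed.

Lemma sylD b i j : syl b (i + j)%R = syl b i * syl b j.
Proof.
apply/esym/val_inj.
rewrite -[LHS]/(mulred p (mulsyl p (b, i) [::]) (mulsyl p (b, j) [::])).
by rewrite mulred_mulsyl ?mulsyl_reduced //; apply: mulsylD.
Qed.

Lemma syl_eq1 b i : (syl b i == 1) = (p b %| i)%Z.
Proof.
rewrite -val_eqE /= /consyl (sameP dvdz_mod0P eqP).
by case: ifP.
Qed.

Lemma syl0 b : syl b 0 = 1.
Proof. by apply/eqP; rewrite syl_eq1 dvdz0. Qed.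

Lemma sylN b i : syl b (- i)%R = (syl b i)^-1.
Proof. by apply/esym/mulg1_eq; rewrite -sylD subrr syl0. Qed.

Lemma zpow_syl b i j : zpow (syl b i) j = syl b (i * j)%R.
Proof.
elim/int_rect: j => [|n IH|n IH]; first by rewrite mulr0 syl0.
  by rewrite intS mulrDr mulr1 zpowD sylD IH.
by rewrite intS opprD mulrDr mulrN1 zpowD sylD IH zpowN sylN.
Qed.

Lemma syl_mod b i : syl b (i %% p b)%Z = syl b i.
Proof.
have e : syl b ((i %/ p b)%Z * p b)%R = 1.
  by apply/eqP; rewrite syl_eq1 dvdz_mull.
by rewrite -[LHS]mul1g -e -sylD -divz_eq.
Qed.

Lemma eq_syl b i j : (i = j %[mod p b])%Z -> syl b i = syl b j.
Proof. by move=> e; rewrite -(syl_mod b i) e syl_mod. Qed.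

Lemma fpmk_inv s : fpmk (invred p s) = (fpmk s)^-1.
Proof.
rewrite /invred; elim: s => [|x s IH] /=; first by rewrite invg1.
by rewrite rev_cons -cats1 fpmk_cat IH /= mulg1 syl_mod sylN invgM.
Qed.

Lemma fpmk_flatten n s : fpmk (flatten (nseq n s)) = fpmk s ^+ n.
Proof. by elim: n => //= n IH; rewrite fpmk_cat IH expgS. Qed.

Lemma size_fpmk s : size (val (fpmk s)) <= size s.
Proof. by rewrite val_fpmk -[leqRHS]addn0 size_mulred. Qed.

(* A product of full length has no cancellation. *)
Lemma fpmk_full_size s t : all (cansyl p) s -> reduced p t ->
  size s = size t -> fpmk s = fpmk t -> s = t.
Proof.
move=> cs rt est e.
have rs : reduced p s.
  rewrite -[s]cats0; apply: reduced_size => //.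
  by rewrite addn0 -val_fpmk e val_fpmk_reduced.
by rewrite -(val_fpmk_reduced rs) e val_fpmk_reduced.
Qed.

Lemma reduced_flatten n x s t : reduced p (x :: s) -> (last x s).1 != x.1 ->
  reduced p t -> (if t is y :: _ then (last x s).1 != y.1 else true) ->
  reduced p (flatten (nseq n (x :: s)) ++ t).
Proof.
move=> rs hl rt ht; set r := _ ++ t.
(* The head condition is carried through the induction, since each further copy is attached on the
   left. *)
suff: reduced p r && (if r is y :: _ then (last x s).1 != y.1 else true) by case/andP.
rewrite {}/r; elim: n => [|n]; rewrite ?rt // -catA.
case: (flatten _ ++ t) => [|y r] /andP[rr hy]; first by rewrite cats0 rs hl.
by rewrite reduced_cat rs hy rr.
Qed.

(** The end syllables lie in different factors, so concatenated copies stay reduced and form a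
    nonempty normal form. *)
Lemma cyclically_reduced_neq1 n x s : reduced p (x :: s) ->
  (last x s).1 != x.1 -> 0 < n -> fpmk (x :: s) ^+ n <> 1.
Proof.
case: n => // n rs hl _; rewrite -fpmk_flatten => /(congr1 val).
by rewrite val_fpmk_reduced // -[flatten _]cats0 reduced_flatten.
Qed.

(** Induction on length. If the end syllables lie in the same factor, conjugation by the first one
    merges them and shortens the word; otherwise the word is cyclically reduced and has infinite
    order. *)
Lemma torsion_conj g n : 0 < n -> g ^+ n = 1 ->
  exists h b i, g = h * syl b i * h^-1.
Proof.
move=> n0; have [k] := ubnP (size (val g)); elim: k => // k IH in g *.
move=> sz gn; move: (fpmk_val g) (valP g) sz.
case: (val g) => [|x s] /= eg rs sz.
  by exists 1, true, 0%R; rewrite syl0 !mul1g invg1 -eg.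
case: (lastP s) => [|s' y] in eg rs sz *.
  by exists 1, x.1, x.2; rewrite mul1g invg1 mulg1 -eg /= mulg1.
have [exy|nxy] := eqVneq y.1 x.1; last first.
  have := @cyclically_reduced_neq1 n x (rcons s' y) rs.
  by rewrite last_rcons => /(_ nxy n0); rewrite /= eg.
pose g' := (syl x.1 x.2)^-1 * g * syl x.1 x.2.
have eg' : g' = fpmk (rcons s' (x.1, (y.2 + x.2)%R)).
  rewrite /g' -eg mulgA mulVg mul1g -!cats1 !fpmk_cat /= !mulg1 -mulgA.
  by rewrite sylD exy.
have eg2 : g = syl x.1 x.2 * g' * (syl x.1 x.2)^-1.
  by rewrite /g' !mulgA mulgV mul1g mulgK.
have [||h [b [i e]]] := IH g'.
- rewrite eg'; apply: leq_ltn_trans (size_fpmk _) _.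
  by move: sz; rewrite !size_rcons; lia.
- have := zpow_conj g (syl x.1 x.2)^-1 n; rewrite /= invgK => ->.
  by rewrite gn mulg1 mulVg.
exists (syl x.1 x.2 * h), b, i.
by rewrite eg2 e invgM !mulgA.
Qed.

Lemma centralizer_syl b i g : p b = 0 -> i != 0%R ->
  commute g (syl b i) -> exists j, g = syl b j.
Proof.
move=> pb i0 cg.
have cb j : j != 0%R -> cansyl p (b, j) by rewrite /cansyl pb modz0 eqxx andbT.
(* If [s] does not begin in the factor [b], then [(b, i) :: s] is reduced and [s] followed by
   [(b, i)] is an equally long word of the same value. The two words coincide, so a nonempty [s]
   would begin in [b] after all. *)
have key s : reduced p s -> (if s is x :: _ then b != x.1 else true) ->
    commute (fpmk s) (syl b i) -> s = [::].
  case: s => // x s rs hd c; exfalso.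
  have rr : reduced p ((b, i) :: x :: s) by rewrite reduced_cons cb // rs.
  have : (x :: s) ++ [:: (b, i)] = (b, i) :: x :: s.
    apply: fpmk_full_size => //.
    - by rewrite all_cat; case/andP: rs => -> _ /=; rewrite cb.
    - by rewrite size_cat addnC.
    - by rewrite fpmk_cat /= mulg1.
  by case=> ex _; move: hd; rewrite ex eqxx.
move: (fpmk_val g) (valP g); case: (val g) => [|x s] eg rs.
  by exists 0%R; rewrite syl0 -eg.
have [ebx|nbx] := eqVneq b x.1; last first.
  by have := key _ rs; rewrite eg => /(_ nbx cg).
move: rs; rewrite reduced_cons => /and3P[_ rs hd].
have es : s = [::].
  apply: key => //; first by rewrite ebx.
  have -> : fpmk s = (syl b x.2)^-1 * g by rewrite -eg /= ebx mulKg.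
  apply/commute_sym/commuteM; last exact/commute_sym.
  by apply: commuteV; rewrite /commute -!sylD addrC.
by exists x.2; rewrite -eg es /= mulg1 ebx.
Qed.

End FreeProductTheory.

(** * Centralizer of a power of a product of two syllables *)

(** Comparing first letters peels copies of [[:: x; y]] off [s]; a leftover single letter would
    force [x = y]. *)
Lemma cat_flatten_comm (T : eqType) (x y : T) n s : x != y -> 0 < n ->
  s ++ flatten (nseq n [:: x; y]) = flatten (nseq n [:: x; y]) ++ s ->
  exists k, s = flatten (nseq k [:: x; y]).
Proof.
move=> nxy; case: n => // n _.
have eV : flatten (nseq n.+1 [:: x; y]) = flatten (nseq n [:: x; y]) ++ [:: x; y].
  by rewrite -(addn1 n) nseqD flatten_cat.
have [k] := ubnP (size s); elim: k => // k IH in s *.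
case: s => [|a [|b s]] /= sz; first by exists 0.
  by case=> _ exy; rewrite exy eqxx in nxy.
case=> -> -> e; have [||j ->] := IH s; first by lia.
  by rewrite [RHS](_ : _ = flatten (nseq n [:: x; y]) ++ [:: x, y & s]) // eV -catA.
by exists j.+1.
Qed.

Section PairCentralizer.
Variable p : bool -> nat.
Implicit Types (x y : bool * int) (g : freeprod p).

(** When [g] begins in the factor of [x], the power followed by [g] is reduced, so commutation in
    the group becomes commutation of words. *)
Lemma centralizer_pair_head x y n g : 0 < n ->
  reduced p [:: x; y] -> commute g (fpmk p [:: x; y] ^+ n) ->
  (if val g is a :: _ then a.1 == x.1 else true) ->
  exists k, g = fpmk p [:: x; y] ^+ k.
Proof.
move=> n0 rxy; have nxy : y.1 != x.1.
  by rewrite eq_sym; case/andP: rxy => _ /andP[].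
rewrite -fpmk_flatten -{1}(fpmk_val g); move: (valP g).
set V := flatten _ => rs.
have cV : all (cansyl p) V.
  by rewrite /V; apply/allP => a /flattenP[_ /nseqP[-> _]]; apply/allP; case/andP: rxy.
case es : (val g) => [|a s] in rs * => cg ea; first by exists 0; rewrite -[g]fpmk_val es.
have [k ek] : exists k, a :: s = flatten (nseq k [:: x; y]).
  apply: (@cat_flatten_comm _ _ _ n) => //.
    by apply: contraNneq nxy => ->.
  rewrite -/V; apply: (@fpmk_full_size p).
  - by rewrite all_cat cV andbT; case/andP: rs.
  - by apply: reduced_flatten; rewrite //= (eqP ea).
  - by rewrite !size_cat addnC.
  - by rewrite !fpmk_cat.
by exists k; rewrite -fpmk_flatten -ek -es fpmk_val.
Qed.

Lemma centralizer_pair x y i g : reduced p [:: x; y] -> i != 0%R ->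
  commute g (zpow (fpmk p [:: x; y]) i) -> exists k, g = zpow (fpmk p [:: x; y]) k.
Proof.
move=> rxy i0 cg; set z := fpmk p [:: x; y] in cg *.
have [n n0 cn] : exists2 n, 0 < n & commute g (z ^+ n).
  case: i i0 cg => [[|n]|n] // _; first by exists n.+1.
  by rewrite /= expVgn => /commuteV; rewrite invgK; exists n.+1.
have nxy : x.1 != y.1 by case/andP: rxy => _ /andP[].
have [hx|hx] := boolP (if val g is a :: _ then a.1 == x.1 else true).
  by have [k ->] := centralizer_pair_head n0 rxy cn hx; exists k%:Z%R.
(* An element beginning in the factor of [y] is treated with [z^-1], whose word begins in that
   factor. *)
have zV : z^-1 = fpmk p [:: oppsyl p y; oppsyl p x] by rewrite -fpmk_inv.
have [||||k ek] := @centralizer_pair_head (oppsyl p y) (oppsyl p x) n g.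
- by [].
- exact: (@invred_reduced p [:: x; y]).
- by rewrite -zV expVgn; apply: commuteV.
- case: (val g) hx => // a s; rewrite /=.
  by case: a.1 x.1 y.1 nxy => [] [] [].
by exists (- k%:Z)%R; rewrite ek -zV expVgn zpowN.
Qed.

End PairCentralizer.

(** * Involutions in the free product of Z/2 and Z/(2l+1) *)

Section InvolutionProduct.
Variables (p : bool -> nat) (l : nat).
Hypotheses (p0 : p false = 2) (p1 : p true = l.*2.+1) (l0 : 0 < l).
Implicit Types (h : freeprod p).

(** For label 2l+1, [d] and [u 1] stand for the images of $\Delta_B$ and $u_B$. Since $\Delta_B =
    u_B^l b_1$ and u has order 2l+1, the image of $b_1$ is $u^{-l}d = u^{l+1}d$. *)
Let d := syl p false 1.
Let u i := syl p true i.
Let b1 := fpmk p [:: (true, l.+1%:Z%R); (false, 1%R)].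

Lemma cansyl_false i : cansyl p (false, i) -> i = 1%R.
Proof.
rewrite /cansyl /= p0 => /andP[nz /eqP e].
have := modz_ge0 i (d := 2) isT; have := ltz_mod i (d := 2) isT; lia.
Qed.

Lemma cansyl_true i : cansyl p (true, i) -> (0 < i < l.*2.+1%:Z)%R.
Proof.
rewrite /cansyl /= p1 => /andP[nz /eqP e].
have := modz_ge0 i (d := l.*2.+1) isT; have := ltz_mod i (d := l.*2.+1) isT; lia.
Qed.

Lemma true_cansyl (i : int) : (0 < i < l.*2.+1%:Z)%R -> cansyl p (true, i).
Proof.
by move=> hi; rewrite /cansyl /= p1 modz_small; [rewrite eqxx andbT|]; lia.
Qed.

Lemma b1E : b1 = u l.+1 * d. Proof. by rewrite /b1 /= mulg1. Qed.

Lemma b1V : b1^-1 = d * u l.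
Proof.
have ed : d^-1 = d.
  by apply: mulg1_eq; rewrite -sylD; apply/eqP; rewrite syl_eq1 p0.
rewrite b1E invgM ed -sylN; congr (_ * _); apply: (mulgI (u l.+1)).
rewrite -!sylD subrr syl0; apply/esym/eqP; rewrite syl_eq1 p1.
by apply/dvdzP; exists 1%R; lia.
Qed.

(** As [s] and its inverse begin and end with [d], all junctions are between different factors. The
    word begins with a power of [u] and ends with [d], so it is cyclically reduced. *)
Lemma conj_pair_neq1 s i j : reduced p s ->
  (if s is x :: s' then ~~ x.1 && ~~ (last x s').1 else false) ->
  cansyl p (true, i) -> cansyl p (true, j) ->
  (u i * fpmk p s * u l * (fpmk p s)^-1 * u j * d) ^+ 2 <> 1.
Proof.
case: s => // x s rs /andP[hx hl] ci cj.
have cl : cansyl p (true, Posz l) by apply: true_cansyl; lia.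
have cd : cansyl p (false, 1%R) by rewrite /cansyl /= p0.
have [y [t [eV hy ht]]] : exists y t, [/\ invred p (x :: s) = y :: t,
    ~~ y.1 & ~~ (last y t).1].
  case: (lastP s) hl => [|s' z] hl.
    by exists (oppsyl p x), [::].
  exists (oppsyl p z), (rcons (rev (map (oppsyl p) s')) (oppsyl p x)).
  rewrite last_rcons; split => //; last by move: hl; rewrite last_rcons.
  by rewrite /invred /= map_rcons rev_cons rev_rcons.
have rV : reduced p (y :: t) by rewrite -eV invred_reduced.
rewrite -fpmk_inv eV => e.
have r3 : reduced p [:: (true, j); (false, 1%R)] by rewrite /reduced /= cj cd.
have r2 : reduced p ((y :: t) ++ [:: (true, j); (false, 1%R)]).
  by rewrite reduced_cat rV r3 /= andbT; case: (last _ _).1 ht.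
have r1 : reduced p ((x :: s) ++ (true, Posz l) :: (y :: t) ++ [:: (true, j); (false, 1%R)]).
  rewrite reduced_cat rs reduced_cons cl r2 /=.
  by case: (last _ _).1 hl => // _; case: y.1 hy.
pose L := (x :: s) ++ (true, Posz l) :: (y :: t) ++ [:: (true, j); (false, 1%R)].
have rL : reduced p ((true, i) :: L).
  by rewrite reduced_cons ci r1 /L /=; case: x.1 hx.
apply: (@cyclically_reduced_neq1 p 2 (true, i) L) => //.
  by rewrite /L last_cat /= last_cat.
have -> // : fpmk p ((true, i) :: L) =
    u i * fpmk p (x :: s) * u l * fpmk p (y :: t) * u j * d.
rewrite /L -cat1s !fpmk_cat (fpmk_cat _ [:: _] ((y :: t) ++ _)).
by rewrite !fpmk_cat /= !mulg1 !mulgA.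
Qed.

(* Left factors [b1^(+-1)] and right factors [u^i] are stripped off [h] until
   nothing is left; if this gets stuck, the product is conjugate to a cyclically
   reduced word of positive length, hence has infinite order. *)
Lemma involution_conj h : (h * u l * h^-1 * b1) ^+ 2 = 1 ->
  exists k i, h = zpow b1 k * u i.
Proof.
have [n] := ubnP (size (val h)); elim: n => // n IH in h *.
move=> sz eh; move: (fpmk_val h) (valP h) sz.
case: (lastP (val h)) => [|s [[] i]] es rs sz.
- by exists 0%R, 0%R; rewrite -es /u syl0 !mul1g.
- have rs' : reduced p s.
    move: rs; rewrite -cats1; case: (s) => // x s'.
    by rewrite reduced_cat => /and3P[].
  (* A final power of [u] commutes with [u l] and drops out of the conjugate. *)
  have eg : h = fpmk p s * u i by rewrite -es -cats1 fpmk_cat /= mulg1.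
  have [||k [j ej]] := IH (fpmk p s).
  + by rewrite val_fpmk_reduced //; move: sz; rewrite size_rcons.
  + rewrite -eh; congr ((_ * _) ^+ 2).
    have cu : u i * u l = u l * u i by rewrite -!sylD addrC.
    by rewrite eg invgM -(mulgA _ (u i)) cu !mulgA mulgK.
  by exists k, (j + i)%R; rewrite eg ej /u sylD mulgA.
have ed : d^-1 = d.
  by apply: mulg1_eq; rewrite -sylD; apply/eqP; rewrite syl_eq1 p0.
case: s => [|[[] j] s] in es rs sz *.
(* Here [h = d], and $b_1^{-1} = d u^l$ gives $d = b_1^{-1}u^{-l}$. *)
- exists (-1)%R, (- l%:Z)%R; rewrite (zpowN _ 1) /= b1V -es /= mulg1.
  move: rs; rewrite /= reduced_cons => /andP[/cansyl_false -> _].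
  by rewrite -mulgA -sylD subrr syl0 mulg1.
- (* [h] starts with [u^j] and ends with [d]. *)
  move: rs; rewrite rcons_cons reduced_cons => /and3P[cj rs hd].
  set s' := rcons s _ in es sz rs hd.
  have hs' : is_true (if s' is x :: s0 then ~~ x.1 && ~~ (last x s0).1 else false).
    move: hd; rewrite /s'; case: (s) => [|x s0] //=; rewrite last_rcons.
    by case: x.1.
  have eg : h = u j * fpmk p s' by rewrite -es.
  have [ejl|njl] := eqVneq j l.+1%:Z%R.
    case es' : s' hs' => [|[b k] s0] //= /andP[hb _].
    move: rs; rewrite es' reduced_cons => /and3P[ck rs0 _].
    have {}hb : b = false by apply/negbTE.
    rewrite hb in ck es'; rewrite (cansyl_false ck) in es'.
    have eg0 : h = b1 * fpmk p s0 by rewrite eg es' ejl b1E -mulgA.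
    have [||k' [j' ej']] := IH (fpmk p s0).
    + rewrite val_fpmk_reduced //; move: sz; rewrite rcons_cons /= -/s' es' /=; lia.
    + have := zpow_conj (h * u l * h^-1 * b1) b1^-1 2.
      rewrite /= eh invgK mulg1 mulVg => <-; congr (_ ^+ 2).
      by rewrite eg0 conj_mul_shift.
    by exists (1 + k')%R, j'; rewrite zpow1D eg0 ej' mulgA.
  (* The product is $u^j s' u^l s'^{-1} u^{l+1-j} d$; [e] is the residue of l+1-j, nonzero because j
     differs from l+1. *)
  pose e := (if (j <= l%:Z)%R then l.+1%:Z - j else l.+1%:Z - j + l.*2.+1%:Z)%R.
  have ce : cansyl p (true, e).
    by apply: true_cansyl; rewrite /e; have := cansyl_true cj; case: ifP; lia.
  case: (conj_pair_neq1 rs hs' cj ce); rewrite {ce}/e.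
  rewrite -eh eg b1E invgM !mulgA; congr (_ ^+ 2); congr (_ * _).
  rewrite -!mulgA -!sylN -!sylD; do 4!congr (_ * _).
  apply: eq_syl; rewrite p1 [(- j + _)%R]addrC.
  by case: ifP => _ //; rewrite modzDr.
(* [h] starts and ends with [d]. *)
move: rs; rewrite rcons_cons reduced_cons => /and3P[/cansyl_false ej rs hd].
subst j.
case: s => [|[b j] s] in es sz rs hd *; first by [].
have {}hd : b = true by move: hd; rewrite /=; case: (b).
subst b.
move: rs; rewrite rcons_cons reduced_cons => /and3P[cj rs hd].
set s2 := rcons s _ in rs hd.
have hs2 : is_true (if s2 is x :: s0 then ~~ x.1 && ~~ (last x s0).1 else false).
  move: hd; rewrite /s2; case: (s) => [|x s0] //=; rewrite last_rcons.
  by case: x.1.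
have eg : h = d * u j * fpmk p s2 by rewrite -es -mulgA.
have [ejl|njl] := eqVneq j l%:Z%R.
  have eg0 : h = b1^-1 * fpmk p s2 by rewrite eg ejl b1V.
  have [||k' [j' ej']] := IH (fpmk p s2).
  + rewrite val_fpmk_reduced //; move: sz; rewrite !rcons_cons /= -/s2; lia.
  + have := zpow_conj (h * u l * h^-1 * b1) b1 2.
    rewrite /= eh mulg1 mulgV => <-; congr (_ ^+ 2).
    by rewrite eg0 conj_mul_shiftV.
  by exists (-1 + k')%R, j'; rewrite zpowD (zpowN _ 1) eg0 ej' mulgA.
(* Conjugation by [b1] turns the product into $u^{l+1+j} s_2 u^l s_2^{-1} u^{-j} d$, the two letters
   [d] in front cancelling. [e] is the residue of l+1+j, nonzero because j differs from l. *)
pose e := (if (j < l%:Z)%R then l.+1%:Z + j else j - l%:Z)%R.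
have ce : cansyl p (true, e).
  by apply: true_cansyl; rewrite /e; have := cansyl_true cj; case: ifP; lia.
have cf : cansyl p (true, l.*2.+1%:Z - j)%R.
  by apply: true_cansyl; have := cansyl_true cj; lia.
case: (conj_pair_neq1 rs hs2 ce cf).
have e1 : u e = u l.+1 * u j.
  rewrite -sylD; apply: eq_syl; rewrite p1 /e.
  by case: ifP => // _; rewrite -[in LHS]modzDr; congr (modz _ _); lia.
have e2 : u (l.*2.+1%:Z - j)%R = (u j)^-1.
  by rewrite -sylN; apply: eq_syl; rewrite p1 addrC modzDr.
rewrite e1 e2.
have := zpow_conj (h * u l * h^-1 * b1) b1 2.
rewrite /= eh mulg1 mulgV => <-; congr (_ ^+ 2).
rewrite (mulgA b1 _ b1) mulgK eg b1E !invgM ed !mulgA.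
have dd : d * d = 1 by rewrite -{2}ed mulgV.
by rewrite -(mulgA (u l.+1) d d) dd mulg1.
Qed.

End InvolutionProduct.

(** * Dihedral Artin groups *)

Section ArtinGroup.
Variable m : option nat.
Implicit Types u v w : word.

Lemma weq_catl w u v : weq m u v -> weq m (w ++ u) (w ++ v).
Proof.
elim=> {u v} [u|u v _|u v r _ IH1 _|u v x|u v k mk]; first exact: weq_refl.
- exact: weq_sym.
- exact: weq_trans.
- by rewrite !catA; apply: weq_cancel.
- by rewrite !(catA w); apply: weq_rel.
Qed.

Lemma weq_catr w u v : weq m u v -> weq m (u ++ w) (v ++ w).
Proof.
elim=> {u v} [u|u v _|u v r _ IH1 _|u v x|u v k mk]; first exact: weq_refl.
- exact: weq_sym.
- exact: weq_trans.
- by rewrite -!catA; apply: weq_cancel.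
- by rewrite -!catA; apply: weq_rel.
Qed.

Lemma weq_cat u u' v v' : weq m u u' -> weq m v v' -> weq m (u ++ v) (u' ++ v').
Proof. by move=> hu hv; apply: weq_trans (weq_catr _ hu) (weq_catl _ hv). Qed.

Lemma linvK : involutive linv.
Proof. by case=> b c; rewrite /linv /= negbK. Qed.

Lemma winvK : involutive winv.
Proof. by move=> w; rewrite /winv map_rev revK mapK //; apply: linvK. Qed.

Lemma weq_mulV w : weq m (w ++ winv w) [::].
Proof.
rewrite /winv; elim: w => [|x w IH] /=; first exact: weq_refl.
rewrite rev_cons -cats1 catA.
apply: weq_trans (weq_catl [:: x] (weq_catr [:: linv x] IH)) _.
exact: (@weq_cancel m [::] [::]).
Qed.

Lemma weq_Vmul w : weq m (winv w ++ w) [::].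
Proof. by have := weq_mulV (winv w); rewrite winvK. Qed.

Lemma weq_winv u v : weq m u v -> weq m (winv u) (winv v).
Proof.
move=> e; apply: (@weq_trans _ _ (winv u ++ v ++ winv v)).
  by rewrite -{1}[winv u]cats0; apply/weq_catl/weq_sym/weq_mulV.
rewrite catA -[X in weq m _ X]cat0s; apply: weq_catr.
exact: weq_trans (weq_catl _ (weq_sym e)) (weq_Vmul u).
Qed.

(** A classical boolean form of [weq], from which the quotient type is built. *)
Definition weqb u v : bool := `[< weq m u v >].

Lemma weqb_refl : reflexive weqb.
Proof. by move=> u; apply/asboolP/weq_refl. Qed.
Lemma weqb_sym : symmetric weqb.
Proof. by move=> u v; apply/asboolP/asboolP; apply: weq_sym. Qed.
Lemma weqb_trans : transitive weqb.
Proof. by move=> v u w /asboolP h /asboolP h'; apply/asboolP/(weq_trans h h'). Qed.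

Canonical weqb_equiv := EquivRel weqb weqb_refl weqb_sym weqb_trans.

Definition artin := {eq_quot weqb}%qT.
HB.instance Definition _ := Choice.on artin.
HB.instance Definition _ := EqQuotient.on artin.

Definition cl w : artin := (\pi_artin w)%qT.

Lemma clP u v : cl u = cl v <-> weq m u v.
Proof.
split=> [e|e]; last by apply/eqquotP/asboolP.
by move/eqP: e; rewrite eqquotE => /asboolP.
Qed.

Lemma cl_repr (a : artin) : cl (repr a) = a.
Proof. exact: reprK. Qed.

Lemma repr_cl w : weq m (repr (cl w)) w.
Proof. by apply/clP; rewrite cl_repr. Qed.

Definition amul (a b : artin) := cl (repr a ++ repr b).
Definition ainv (a : artin) := cl (winv (repr a)).

Lemma amulE u v : amul (cl u) (cl v) = cl (u ++ v).
Proof. by apply/clP/weq_cat; apply: repr_cl. Qed.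

Lemma amulA : associative amul.
Proof.
move=> a b c; rewrite -(cl_repr a) -(cl_repr b) -(cl_repr c).
by rewrite !amulE catA.
Qed.
Lemma amul1 : left_id (cl [::]) amul.
Proof. by move=> a; rewrite -(cl_repr a) amulE. Qed.
Lemma amulr1 : right_id (cl [::]) amul.
Proof. by move=> a; rewrite -(cl_repr a) amulE cats0. Qed.
Lemma amulV : left_inverse (cl [::]) ainv amul.
Proof. by move=> a; rewrite -{2}(cl_repr a) amulE; apply/clP/weq_Vmul. Qed.
Lemma amulrV : right_inverse (cl [::]) ainv amul.
Proof. by move=> a; rewrite -{1}(cl_repr a) amulE; apply/clP/weq_mulV. Qed.

HB.instance Definition _ := isGroup.Build artin amulA amul1 amulr1 amulV amulrV.

Lemma cl_nil : cl [::] = 1. Proof. by []. Qed.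

Lemma cl_cat u v : cl (u ++ v) = cl u * cl v.
Proof. by rewrite -amulE. Qed.

Lemma cl_winv w : cl (winv w) = (cl w)^-1.
Proof. by apply/clP/weq_winv/weq_sym/repr_cl. Qed.

Lemma cl_flatten n w : cl (flatten (nseq n w)) = cl w ^+ n.
Proof. by elim: n => //= n IH; rewrite cl_cat IH expgS. Qed.

Lemma cl_wpow w t : cl (wpow w t) = zpow (cl w) t.
Proof. by case: t => n; rewrite /wpow cl_flatten // cl_winv. Qed.

End ArtinGroup.

(** * Consequences of the Artin relation in an arbitrary group *)

Section AlternatingProducts.
Variable G : groupType.
Implicit Types x y : G.

Fixpoint altp x y n : G := if n is n'.+1 then x * altp y x n' else 1.

Lemma altp_double x y n : altp x y n.*2 = (x * y) ^+ n.
Proof. by elim: n => //= n IH; rewrite IH expgS mulgA. Qed.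

Lemma altp_doubleS x y n : altp x y n.*2.+1 = x * (y * x) ^+ n.
Proof. by rewrite /= altp_double. Qed.

Lemma mulg_expC x y n : x * (y * x) ^+ n = (x * y) ^+ n * x.
Proof.
elim: n => [|n IH]; first by rewrite mulg1 mul1g.
by rewrite expgSr !mulgA IH expgSr -!mulgA.
Qed.

Lemma altp_odd_commute x y n : commute x y ->
  altp x y n.*2.+1 = altp y x n.*2.+1 -> y = x.
Proof. by move=> c; rewrite !altp_doubleS c => /mulIg. Qed.

(** This is $\Delta^2 = u^m$ for m = 2n+1 and u = xy: one factor is written $u^n x$, the other $y
    u^n$. *)
Lemma altp_odd_sqr x y n : altp x y n.*2.+1 = altp y x n.*2.+1 ->
  ((x * y) ^+ n * x) ^+ 2 = (x * y) ^+ n.*2.+1.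
Proof.
rewrite !altp_doubleS (mulg_expC x) => e.
by rewrite expg2 {2}e -mulgA (mulgA x) -expgS -expgnDr -addnn addnS.
Qed.

(** The power $u^m$ commutes with u and, being $\Delta^2$, with $\Delta = u^n x$; hence with x. This
    serves both for the centrality of $\delta_B$ and for the images of the generators of A. *)
Lemma altp_odd_central x y n : altp x y n.*2.+1 = altp y x n.*2.+1 ->
  commute ((x * y) ^+ n.*2.+1) x.
Proof.
move=> e; set w := x * y.
have cD : commute (w ^+ n.*2.+1) (w ^+ n * x).
  rewrite -(altp_odd_sqr e); apply/commute_sym/commuteX/commute_refl.
have -> : x = (w ^+ n)^-1 * (w ^+ n * x) by rewrite mulKg.
apply: commuteM => //; apply/commuteV/commuteX/commute_sym/commuteX/commute_refl.
Qed.

Lemma altp_even_central x y n : altp x y n.*2 = altp y x n.*2 ->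
  commute ((x * y) ^+ n) x.
Proof. by rewrite !altp_double => e; rewrite /commute -mulg_expC -e. Qed.

Lemma commute_exp_double x y n : commute x y -> altp x y n.*2 = altp y x n.*2.
Proof. by rewrite !altp_double => ->. Qed.

End AlternatingProducts.

(** * Evaluation of words in a group, and weights in the integers *)

Section Evaluation.
Variables (G : groupType) (e : bool -> G).

Definition evl (x : letter) : G := if x.2 then (e x.1)^-1 else e x.1.
Definition ev (w : word) : G := foldr (fun x g => evl x * g) 1 w.

Lemma ev_cat u v : ev (u ++ v) = ev u * ev v.
Proof. by elim: u => [|x u IH] /=; rewrite ?mul1g // IH mulgA. Qed.

Lemma ev_Pi b c n : ev (Pi (b, false) (c, false) n) = altp (e b) (e c) n.
Proof. by elim: n b c => //= n IH b c; rewrite IH. Qed.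

Lemma ev_weq m : (forall k, m = Some k ->
    altp (e false) (e true) k = altp (e true) (e false) k) ->
  forall u v, weq m u v -> ev u = ev v.
Proof.
move=> hm u v; elim=> {u v} [//|//|u v w _ -> _ ->//|u v x|u v k mk].
  rewrite !ev_cat /=; congr (_ * _); rewrite mulgA.
  by case: x => b [] /=; rewrite /evl /= ?mulgV ?mulVg mul1g.
by rewrite !ev_cat !ev_Pi (hm k).
Qed.

End Evaluation.

Section Weights.
Variable c : bool -> int.

Definition wt (w : word) : int :=
  foldr (fun x t => (if x.2 then - c x.1 else c x.1) + t)%R 0%R w.

Lemma wt_cat u v : wt (u ++ v) = (wt u + wt v)%R.
Proof. by elim: u => [|x u IH] /=; rewrite ?add0r // IH addrA. Qed.

(** The condition for weights to respect the relation: for an even label both sides contain each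
    generator equally often, for an odd label the counts differ by one. *)
Definition wteven (m : option nat) :=
  forall k, m = Some k -> odd k -> c true = c false.

Lemma wt_Pi b d n : wt (Pi (b, false) (d, false) n) =
  ((c b + c d) *+ n./2 + (if odd n then c b else 0))%R.
Proof.
elim: n b d => [|n IH] b d /=; first by rewrite mulr0n addr0.
rewrite IH uphalf_half; case: (odd n) => /=; rewrite ?add1n ?add0n ?mulrS; lia.
Qed.

Lemma wt_weq m u v : wteven m -> weq m u v -> wt u = wt v.
Proof.
move=> hm; elim=> {u v} [//|//|u v w _ -> _ ->//|u v x|u v k mk].
  by rewrite !wt_cat /=; case: x => b [] /=; lia.
rewrite !wt_cat !wt_Pi (addrC (c true)).
by case: ifP => // /(hm _ mk) ->.
Qed.

Variable m : option nat.
Hypothesis hm : wteven m.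

Definition awt (a : artin m) : int := wt (repr a).

Lemma awt_cl w : awt (cl m w) = wt w.
Proof. by apply: (wt_weq hm); apply: repr_cl. Qed.

Lemma awtM a b : awt (a * b) = (awt a + awt b)%R.
Proof. by rewrite -(cl_repr a) -(cl_repr b) -cl_cat !awt_cl wt_cat. Qed.

Lemma awt1 : awt 1 = 0%R.
Proof. by have := awtM 1 1; rewrite mulg1; lia. Qed.

Lemma awtV a : awt a^-1 = (- awt a)%R.
Proof. by have := awtM a a^-1; rewrite mulgV awt1; lia. Qed.

Lemma awtX a n : awt (a ^+ n) = (awt a *+ n)%R.
Proof. by elim: n => [|n IH]; rewrite ?awt1 // expgS awtM IH mulrS. Qed.

Lemma awt_zpow a t : awt (zpow a t) = (awt a * t)%R.
Proof.
case: t => n /=; rewrite awtX ?awtV -mulr_natr.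
  by rewrite natz.
by rewrite natz NegzE mulrN mulNr.
Qed.

Lemma awt_conj a b : awt (b * a * b^-1) = awt a.
Proof. by rewrite !awtM awtV; lia. Qed.

Lemma awt_altp_odd a b n :
  altp a b n.*2.+1 = altp b a n.*2.+1 -> awt b = awt a.
Proof.
move/(congr1 awt); rewrite !altp_doubleS !awtM !awtX !awtM.
by rewrite (addrC (awt b) (awt a)); lia.
Qed.

End Weights.

(** * The central quotient as a free product *)

Section Model.
Variable m : option nat.

Definition oddlab := if m is Some k then odd k else false.
Definition lab := if m is Some k then k else 0.

(* The orders of the two free factors of the central quotient, [0] standing
   for an infinite factor. *)
Definition fpord (b : bool) : nat :=
  if oddlab then (if b then lab else 2) else (if b then lab./2 else 0).

Local Notation G := (freeprod fpord).

(** The image of $b_1$: for m = 2l+1 it is $u^{l+1}\Delta$, from $\Delta_B = u_B^l b_1$ and $u^m =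
    1$. Otherwise $b_1$ itself generates the infinite factor. *)
Definition mdl1 : G :=
  if oddlab then fpmk fpord [:: (true, lab./2.+1%:Z%R); (false, 1%R)]
  else syl fpord false 1.
Definition mdl (b : bool) : G :=
  if b then mdl1^-1 * syl fpord true 1 else mdl1.

Lemma mdl_mul : mdl false * mdl true = syl fpord true 1.
Proof. by rewrite /mdl mulVKg. Qed.

Lemma lab_odd : oddlab -> lab = lab./2.*2.+1.
Proof. by rewrite /oddlab /lab; case: m => // k ok; rewrite -[LHS]odd_double_half ok. Qed.

Lemma syl_expn b n : syl fpord b 1 ^+ n = syl fpord b n.
Proof. by rewrite -[LHS]/(zpow _ (Posz n)) zpow_syl mul1r. Qed.

Lemma mdl1_odd : oddlab ->
  syl fpord true 1 ^+ lab./2 * mdl1 = syl fpord false 1.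
Proof.
move=> om; rewrite /mdl1 om /= mulg1 mulgA syl_expn -sylD.
have -> : syl fpord true (lab./2%:Z + lab./2.+1%:Z)%R = 1.
  apply/eqP; rewrite syl_eq1 /fpord om.
  by apply/dvdzP; exists 1%R; rewrite mul1r; have := lab_odd om; lia.
by rewrite mul1g.
Qed.

Lemma mdl_rel k : m = Some k ->
  altp (mdl false) (mdl true) k = altp (mdl true) (mdl false) k.
Proof.
move=> mk; have lk : lab = k by rewrite /lab mk.
have [ok|ek] := boolP (odd k).
  have om : oddlab by rewrite /oddlab mk.
  rewrite -lk (lab_odd om) !altp_doubleS mulg_expC mdl_mul mdl1_odd //.
  rewrite /= -mulgA -expgS; apply: (mulgI mdl1); rewrite mulVKg.
  apply: (mulgI (syl fpord true 1 ^+ lab./2)); rewrite mulgA mdl1_odd //.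
  rewrite -expgnDr addnS addnn -(lab_odd om) syl_expn -sylD.
  transitivity (1 : G); last apply: esym; apply/eqP; rewrite syl_eq1 /fpord om //.
have om : oddlab = false by rewrite /oddlab mk (negbTE ek).
have ek2 : k = k./2.*2 by rewrite -[LHS]odd_double_half (negbTE ek).
have u1 : syl fpord true 1 ^+ k./2 = 1.
  by rewrite syl_expn; apply/eqP; rewrite syl_eq1 /fpord om lk.
rewrite ek2 !altp_double mdl_mul u1; apply/esym.
apply: (mulgI (mdl false)); rewrite mulg_expC mdl_mul u1.
by rewrite mul1g mulg1.
Qed.

Definition Phi (a : artin m) : G := ev mdl (repr a).

Lemma Phi_cl w : Phi (cl m w) = ev mdl w.
Proof. by apply: (ev_weq mdl_rel); apply: repr_cl. Qed.

Lemma PhiM a b : Phi (a * b) = Phi a * Phi b.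
Proof. by rewrite -(cl_repr a) -(cl_repr b) -cl_cat !Phi_cl ev_cat. Qed.

Lemma Phi1 : Phi 1 = 1.
Proof. by rewrite -cl_nil Phi_cl. Qed.

Lemma PhiV a : Phi a^-1 = (Phi a)^-1.
Proof. by apply/esym/mulg1_eq; rewrite -PhiM mulgV Phi1. Qed.

Lemma PhiX a n : Phi (a ^+ n) = Phi a ^+ n.
Proof. by elim: n => [|n IH]; rewrite ?Phi1 // !expgS PhiM IH. Qed.

Lemma Phi_zpow a t : Phi (zpow a t) = zpow (Phi a) t.
Proof. by case: t => n /=; rewrite PhiX ?PhiV. Qed.

Local Notation x := (cl m x1).
Local Notation y := (cl m x2).

Lemma Phi_x1 : Phi x = mdl1.
Proof. by rewrite Phi_cl /= mulg1. Qed.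

Lemma Phi_x2 : Phi y = mdl1^-1 * syl fpord true 1.
Proof. by rewrite Phi_cl /= mulg1. Qed.

Lemma cl_uB : cl m uB = x * y.
Proof. by rewrite -cl_cat. Qed.

Lemma cl_Pi12 n : cl m (Pi g1 g2 n) = altp x y n /\ cl m (Pi g2 g1 n) = altp y x n.
Proof.
elim: n => // n [IH1 IH2] /=.
by split; rewrite -cat1s cl_cat ?IH1 ?IH2.
Qed.

Lemma artin_rel k : m = Some k -> altp x y k = altp y x k.
Proof.
move=> mk; have [<- <-] := cl_Pi12 k; apply/clP.
by have := @weq_rel m [::] [::] k mk; rewrite !cats0.
Qed.

(* Lifts to the Artin group of the generators of the free factors. *)
Definition fgen (b : bool) : artin m :=
  if b then x * y else if oddlab then cl m (Garside lab) else x.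
Definition zgen : artin m := if m is Some k then cl m (deltaB k) else 1.

Lemma fgen_false_odd : oddlab -> fgen false = (x * y) ^+ lab./2 * x.
Proof.
move=> om; rewrite /fgen om /Garside (cl_Pi12 _).1 {1}(lab_odd om).
by rewrite altp_doubleS mulg_expC.
Qed.

(** $\delta_B$ is $u_B^m$ for odd m, by $\Delta_B^2 = u_B^m$, and $u_B^{m/2}$ for even m. For an
    infinite label the exponent is 0 and both sides are 1. *)
Lemma zgen_true : zgen = fgen true ^+ fpord true.
Proof.
rewrite /zgen /fgen /fpord /oddlab /lab.
case em : m => [k|] //=; rewrite -em /deltaB; case: ifPn => ok.
  rewrite cl_cat (cl_Pi12 _).1; have rel := artin_rel em.
  have ek : k = k./2.*2.+1 by rewrite -[LHS]odd_double_half ok.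
  rewrite ek in rel; rewrite [in RHS]ek -(altp_odd_sqr rel).
  by rewrite ek altp_doubleS mulg_expC -ek.
have ek : k = k./2.*2 by rewrite -[LHS]odd_double_half (negbTE ok).
by rewrite /Garside (cl_Pi12 _).1 {1}ek altp_double.
Qed.

Lemma zgen_false : oddlab -> zgen = fgen false ^+ fpord false.
Proof.
move=> om; rewrite /fgen /fpord om /zgen; move: om; rewrite /oddlab /lab.
by case em : m => [k|] // ok; rewrite /deltaB ok cl_cat.
Qed.

Lemma zgen_x1 : commute x zgen.
Proof.
apply: commute_sym; rewrite zgen_true /fgen /fpord /oddlab /lab.
case em : m => [k|]; last exact/commute_sym/commute1.
have rel := artin_rel em; rewrite -em; case: ifPn => ok.
  have ek : k = k./2.*2.+1 by rewrite -[LHS]odd_double_half ok.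
  by rewrite ek in rel *; apply: altp_odd_central.
have ek : k = k./2.*2 by rewrite -[LHS]odd_double_half (negbTE ok).
by rewrite ek in rel; apply: altp_even_central.
Qed.

Lemma zgen_x2 : commute y zgen.
Proof.
have -> : y = x^-1 * fgen true by rewrite /fgen mulKg.
apply/commute_sym/commuteM; first exact/commuteV/commute_sym/zgen_x1.
by rewrite zgen_true; apply/commute_sym/commuteX/commute_refl.
Qed.

Lemma zgen_central a : commute a zgen.
Proof.
rewrite -(cl_repr a); elim: (repr a) => [|c w IH]; first exact/commute_sym/commute1.
rewrite -cat1s cl_cat; apply/commute_sym/commuteM/commute_sym => //.
case: c => b []; last by case: b; [apply/commute_sym/zgen_x2|apply/commute_sym/zgen_x1].
have -> : cl m [:: (b, true)] = (cl m [:: (b, false)])^-1 by rewrite -cl_winv.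
by apply: commuteV; case: b; [apply/commute_sym/zgen_x2|apply/commute_sym/zgen_x1].
Qed.

Lemma Phi_fgen b : Phi (fgen b) = syl fpord b 1.
Proof.
have e1 : Phi (fgen true) = syl fpord true 1.
  by rewrite /fgen PhiM Phi_x1 Phi_x2 mulVKg.
case: b => //; have [om|/negbTE om] := boolP oddlab.
  rewrite (fgen_false_odd om) PhiM PhiX -[x * y]/(fgen true) e1 Phi_x1.
  exact: mdl1_odd.
by rewrite /fgen om Phi_x1 /mdl1 om.
Qed.

(** Congruence modulo the central subgroup generated by $\delta_B$. *)
Definition eqz (a b : artin m) := exists t, a = zpow zgen t * b.

Lemma zpow_zgen_central a t : commute a (zpow zgen t).
Proof. exact/commute_zpow/zgen_central. Qed.

Lemma eqz_refl a : eqz a a.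
Proof. by exists 0%R; rewrite mul1g. Qed.
Lemma eqz_sym a b : eqz a b -> eqz b a.
Proof. by case=> t ->; exists (- t)%R; rewrite mulgA -zpowD addNr mul1g. Qed.
Lemma eqz_trans b a c : eqz a b -> eqz b c -> eqz a c.
Proof. by move=> [t ->] [s ->]; exists (t + s)%R; rewrite zpowD mulgA. Qed.
Lemma eqzM a a' b b' : eqz a a' -> eqz b b' -> eqz (a * b) (a' * b').
Proof.
move=> [t ->] [s ->]; exists (t + s)%R.
by rewrite zpowD -!mulgA (mulgA a') zpow_zgen_central -!mulgA.
Qed.

Lemma fgen_mod b i : eqz (zpow (fgen b) (i %% fpord b)%Z) (zpow (fgen b) i).
Proof.
apply: eqz_sym; have [zb|pb] : zgen = fgen b ^+ fpord b \/ fpord b = 0.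
- case: b; first by left; apply: zgen_true.
  have [om|/negbTE om] := boolP oddlab; first by left; apply: zgen_false.
  by right; rewrite /fpord om.
- exists (i %/ fpord b)%Z; rewrite zb -[_ ^+ _]/(zpow _ (Posz _)) -zpowM -zpowD.
  by rewrite [(_ * (i %/ _)%Z)%R]mulrC -divz_eq.
by rewrite pb modz0; apply: eqz_refl.
Qed.

Definition fsec (s : seq (bool * int)) : artin m :=
  foldr (fun c g => zpow (fgen c.1) c.2 * g) 1 s.

Lemma fsec_consyl b i s :
  eqz (zpow (fgen b) i * fsec s) (fsec (consyl fpord b i s)).
Proof.
have := eqz_sym (fgen_mod b i); rewrite /consyl; case: eqP => [-> /= h|_ /= h].
  by rewrite -[X in eqz _ X]mul1g; apply: eqzM h (eqz_refl _).
exact: eqzM h (eqz_refl _).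
Qed.

Lemma fsec_mulsyl b i s :
  eqz (zpow (fgen b) i * fsec s) (fsec (mulsyl fpord (b, i) s)).
Proof.
case: s => [|[c j] s] /=; first exact: (@fsec_consyl b i [::]).
case: eqP => [->|_]; last exact: (@fsec_consyl b i ((c, j) :: s)).
by rewrite mulgA -zpowD; apply: fsec_consyl.
Qed.

(** Through the section [fsec], multiplication by [a] follows multiplication by [g] modulo
    $\delta_B$. The relation is multiplicative, so the generators suffice, and its value at [s = 1]
    recovers [a] from [g] up to a power of $\delta_B$; this yields the kernel of [Phi]. *)
Definition tracks (a : artin m) (g : G) :=
  forall s : G, eqz (a * fsec (val s)) (fsec (val (g * s))).

Lemma tracksM a a' g g' : tracks a g -> tracks a' g' -> tracks (a * a') (g * g').
Proof.
move=> h h' s; rewrite -!mulgA; apply: eqz_trans (h _).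
exact: eqzM (eqz_refl _) (h' _).
Qed.

Lemma tracksV a g : tracks a g -> tracks a^-1 g^-1.
Proof.
move=> h s; have := eqzM (eqz_refl a^-1) (eqz_sym (h (g^-1 * s))).
by rewrite mulKg mulVKg.
Qed.

Lemma tracks_fgen b i : tracks (zpow (fgen b) i) (syl fpord b i).
Proof.
move=> s; have -> : val (syl fpord b i * s) = mulsyl fpord (b, i) (val s).
  by rewrite -[LHS]/(mulred _ (mulsyl _ _ _) _) mulred_mulsyl ?valP.
exact: fsec_mulsyl.
Qed.

Lemma tracks_x1 : tracks x mdl1.
Proof.
have [om|/negbTE om] := boolP oddlab; last first.
  have := @tracks_fgen false 1; rewrite /mdl1 om.
  by rewrite -[zpow _ _]/(fgen false) /fgen om.
(* Again $b_1 = u_B^{-l}\Delta_B$ with m = 2l+1. *)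
have -> : x = zpow (fgen true) (- lab./2%:Z)%R * zpow (fgen false) 1.
  by rewrite zpowN -[zpow (fgen false) 1]/(fgen false) fgen_false_odd //= mulKg.
have -> : mdl1 = syl fpord true (- lab./2%:Z)%R * syl fpord false 1.
  by rewrite -mdl1_odd // sylN -syl_expn mulKg.
by apply: tracksM; apply: tracks_fgen.
Qed.

Lemma tracks_x2 : tracks y (mdl1^-1 * syl fpord true 1).
Proof.
have -> : y = x^-1 * zpow (fgen true) 1 by rewrite /= mulKg.
by apply: tracksM; [apply/tracksV/tracks_x1|apply: tracks_fgen].
Qed.

Lemma tracks_Phi a : tracks a (Phi a).
Proof.
rewrite -(cl_repr a); elim: (repr a) => [|c w IH].
  by rewrite Phi1 => s; rewrite !mul1g; apply: eqz_refl.
rewrite -cat1s cl_cat PhiM; apply: tracksM => //.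
case: c => b c; have h : tracks (cl m [:: (b, false)]) (Phi (cl m [:: (b, false)])).
  by case: b; [rewrite Phi_x2; apply: tracks_x2|rewrite Phi_x1; apply: tracks_x1].
case: c => //.
have -> : cl m [:: (b, true)] = (cl m [:: (b, false)])^-1 by rewrite -cl_winv.
by rewrite PhiV; apply: tracksV.
Qed.

Lemma Phi_kernel a b : Phi a = Phi b -> exists t, a = zpow zgen t * b.
Proof.
move=> e; have := tracks_Phi a 1; rewrite e mulg1 => h.
by have := eqz_trans h (eqz_sym (tracks_Phi b 1)); rewrite !mulg1.
Qed.

Lemma Phi_surj (g : G) : exists a, Phi a = g.
Proof.
rewrite -(fpmk_val g); elim: (val g) => [|[b i] s [a ea]].
  by exists 1; rewrite Phi1.
exists (zpow (fgen b) i * a); rewrite PhiM ea Phi_zpow Phi_fgen.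
by rewrite zpow_syl mul1r.
Qed.

End Model.

(** * Homomorphisms between dihedral Artin groups *)

Section Roots.
Variable m : option nat.

Local Notation G := (freeprod (fpord m)).
Local Notation x := (cl m x1).
Local Notation y := (cl m x2).

Lemma half_lab_gt0 : valid_label m -> oddlab m -> 0 < (lab m)./2.
Proof.
rewrite /oddlab /lab; case: m => //= k k2 ok.
by rewrite half_gt0.
Qed.

Lemma centralizer_mdl1 (vm : valid_label m) (g : G) i : i != 0%R ->
  commute g (zpow (mdl1 m) i) -> exists t, g = zpow (mdl1 m) t.
Proof.
move=> i0; rewrite /mdl1; case: ifP => om.
  apply: centralizer_pair => //.
  have := half_lab_gt0 vm om; have := lab_odd om.
  move=> el l0; rewrite /reduced /cansyl /= /fpord om /= !andbT.
  by rewrite modz_small; lia.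
rewrite zpow_syl mul1r => /centralizer_syl[||t ->] //; first by rewrite /fpord om.
by exists t; rewrite zpow_syl mul1r.
Qed.

(** [g ^+ n] centralizes the image of $b_1$, hence is a power of it. If the exponent is nonzero, [g]
    centralizes that power and is itself a power of the image of $b_1$. *)
Lemma mdl1_root (vm : valid_label m) (g : G) n : 0 < n -> commute (g ^+ n) (mdl1 m) ->
  (exists t, g = zpow (mdl1 m) t) \/ g ^+ n = 1.
Proof.
move=> n0 c; have [//|t et] := @centralizer_mdl1 vm (g ^+ n) 1%R isT.
have [t0|nt0] := eqVneq t 0%R; first by right; rewrite et t0.
left; apply: (centralizer_mdl1 vm nt0); rewrite -et.
exact/commuteX/commute_refl.
Qed.

(** The conjugacy in the quotient lifts up to a power of $\delta_B$. That power is absorbed into the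
    exponent, changing it by a multiple of [fpord m b], because $\delta_B$ is a power of the lifted
    generator. *)
Lemma torsion_lift (w : artin m) n : 0 < n -> Phi w ^+ n = 1 ->
  exists beta b t, [/\ w = beta * zpow (fgen m b) t * beta^-1,
    (fpord m b %| (t * n%:Z)%R)%Z & oddlab m || b].
Proof.
move=> n0 wn; have [h [b [c ew]]] := torsion_conj n0 wn.
have [beta eb] := Phi_surj h.
have dvd : (fpord m b %| (c * n%:Z)%R)%Z.
  rewrite -syl_eq1 -zpow_syl; apply/eqP.
  have := zpow_conj (syl (fpord m) b c) h n; rewrite -ew /= wn => e.
  by apply: (mulIg h^-1); apply: (mulgI h); rewrite mulgA -e mul1g mulgV.
have [e we] : exists e, w = zpow (zgen m) e * (beta * zpow (fgen m b) c * beta^-1).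
  by apply: Phi_kernel; rewrite ew !PhiM PhiV Phi_zpow Phi_fgen zpow_syl mul1r eb.
have lift b' c' : zgen m = fgen m b' ^+ fpord m b' ->
    zpow (fgen m b') c' = zpow (fgen m b) c ->
    w = beta * zpow (fgen m b') ((fpord m b')%:Z * e + c')%R * beta^-1.
  move=> zb ec; rewrite we -ec zpowD zpowM -[zpow _ (Posz _)]/(_ ^+ _) -zb.
  by rewrite !mulgA zpow_zgen_central.
have [ob|nob] := boolP (oddlab m || b).
  exists beta, b, ((fpord m b)%:Z * e + c)%R; split=> //.
    apply: lift => //; case: (b) ob => [_|]; first exact: zgen_true.
    by rewrite orbF => om; apply: zgen_false.
  by rewrite mulrDl -mulrA; apply: rpredD => //; apply: dvdz_mulr.
(* In the infinite factor generated by $b_1$ torsion means exponent 0, so [w] is a power of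
   $\delta_B$, hence of $u_B$. *)
case/norP: nob => om /negbTE bf.
have c0 : c = 0%R.
  move: dvd; rewrite bf /fpord (negbTE om) dvd0z mulf_eq0 => /orP[/eqP//|].
  by lia.
exists beta, true, ((fpord m true)%:Z * e + 0)%R; rewrite orbT; split=> //.
  by apply: lift; [apply: zgen_true|rewrite c0].
by rewrite addr0 -mulrA dvdz_mulr.
Qed.

Lemma length_even : wteven (fun=> 1%R) m. Proof. by []. Qed.
Local Notation len := (@awt (fun=> 1%R) m).

Lemma len_x1 : len x = 1%R.
Proof. by rewrite awt_cl. Qed.
Lemma len_x2 : len y = 1%R.
Proof. by rewrite awt_cl. Qed.
Lemma len_u : len (fgen m true) = 2%R.
Proof. by rewrite /fgen awtM // len_x1 len_x2. Qed.

(** The two elements differ by a power of $\delta_B$, whose length is [2 * fpord m true]; if this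
    vanishes, $\delta_B$ is trivial. *)
Lemma Phi_len_inj (a b : artin m) : Phi a = Phi b -> len a = len b -> a = b.
Proof.
move=> e el; have [t et] := Phi_kernel e.
move: el; rewrite et awtM // zgen_true -[_ ^+ _]/(zpow _ (Posz _)) !awt_zpow // len_u.
have [p0|p0] := eqVneq (fpord m true) 0.
  rewrite p0 -[X in zpow X t]/(1 : artin m) => _.
  by case: t {et} => n; rewrite /= ?invg1 expg1n mul1g.
move=> h; have : (2 * (fpord m true)%:Z * t)%R == 0%R by apply/eqP; lia.
rewrite !mulf_eq0 /= eqz_nat (negbTE p0) => /eqP ->.
by rewrite mul1g.
Qed.

End Roots.

(** * Constraints on the image of $a_2$ *)

Section Hom.
Variables (kA : nat) (mB : option nat) (f : word -> word).
Hypothesis vB : valid_label mB.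
Hypothesis homf : is_hom (Some kA) mB f.
Hypothesis f1 : weq mB (f x1) x1.

Let b1 := cl mB x1.
Let b := cl mB (f x2).

Lemma hom_rel : altp b1 b kA = altp b b1 kA.
Proof.
have [fw fM] := homf.
have psiM u v : cl mB (f (u ++ v)) = cl mB (f u) * cl mB (f v).
  by rewrite -cl_cat; apply/clP.
have psi0 : cl mB (f [::]) = 1.
  by have := psiM [::] [::]; rewrite -[LHS]mulg1 => /mulgI.
have e1 : cl mB (f x1) = b1 by apply/clP.
have psiPi n : cl mB (f (Pi g1 g2 n)) = altp b1 b n /\
               cl mB (f (Pi g2 g1 n)) = altp b b1 n.
  elim: n => //= n [IH1 IH2].
  by split; rewrite -cat1s psiM ?IH1 ?IH2 -?e1.
have [<- <-] := psiPi kA; apply/clP/fw.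
by have := @weq_rel (Some kA) [::] [::] kA erefl; rewrite !cats0.
Qed.

Let w := b1 * b.

Lemma bE : b = b1^-1 * w. Proof. by rewrite mulKg. Qed.

Lemma Phi_rel : altp (mdl1 mB) (Phi b) kA = altp (Phi b) (mdl1 mB) kA.
Proof.
have P (c d : artin mB) n : Phi (altp c d n) = altp (Phi c) (Phi d) n.
  by elim: n c d => [|n IH] c d /=; rewrite ?Phi1 // PhiM IH.
by rewrite -Phi_x1 -!P hom_rel.
Qed.

Lemma Phi_b t : Phi w = zpow (mdl1 mB) t -> Phi b = zpow (mdl1 mB) (-1 + t)%R.
Proof. by move=> e; rewrite bE PhiM PhiV Phi_x1 e zpowD. Qed.

(** If [w] becomes a power of $b_1$ in the quotient, the images of $b_1$ and [b] commute, the odd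
    relation identifies them, and equal lengths lift this. Otherwise [w ^+ kA] becomes trivial; it
    is the square of [w ^+ kA./2 * b1], the image of $\Delta_A$. *)
Lemma odd_root : odd kA ->
  b = b1 \/ Phi w ^+ kA = 1 /\ (Phi w ^+ kA./2 * mdl1 mB) ^+ 2 = 1.
Proof.
move=> oA; have ek : kA = kA./2.*2.+1 by rewrite -[LHS]odd_double_half oA.
have rel := hom_rel; rewrite ek in rel.
have c : commute (Phi w ^+ kA) (mdl1 mB).
  rewrite ek -PhiX -Phi_x1 /commute -!PhiM; congr (Phi _).
  exact: altp_odd_central.
have [|[t et]|w1] := mdl1_root vB _ c; first by rewrite ek.
  left; apply: Phi_len_inj; last by apply: awt_altp_odd rel.
  have rel2 := Phi_rel; rewrite ek in rel2.
  rewrite Phi_x1; apply: altp_odd_commute rel2.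
  by rewrite (Phi_b et); apply/commute_zpow/commute_refl.
right; split=> //; rewrite -PhiX -Phi_x1 -PhiM -PhiX (altp_odd_sqr rel).
by rewrite -ek PhiX.
Qed.

Lemma even_root : 0 < kA -> ~~ odd kA ->
  (exists t1 t2, b = zpow (zgen mB) t1 * zpow b1 t2) \/ Phi w ^+ kA./2 = 1.
Proof.
move=> kA0 oA; have ek : kA = kA./2.*2 by rewrite -[LHS]odd_double_half (negbTE oA).
have rel := hom_rel; rewrite ek in rel.
have c : commute (Phi w ^+ kA./2) (mdl1 mB).
  rewrite -PhiX -Phi_x1 /commute -!PhiM; congr (Phi _).
  exact: altp_even_central.
have [|[t et]|w1] := mdl1_root vB _ c; first by lia.
  left; have [|t1 e] := @Phi_kernel mB b (zpow b1 (-1 + t)%R).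
    by rewrite Phi_zpow Phi_x1 (Phi_b et).
  by exists t1, (-1 + t)%R.
by right.
Qed.

(** Weights 1 for $b_1$ and -1 for $b_2$ are allowed here and kill $u_B$. In the torsion case [w] is
    conjugate to a power of $u_B$, so has weight 0; the odd relation gives [b] the weight of [b1],
    so [w] has weight 2. *)
Lemma hom_odd_even : odd kA -> oddlab mB = false -> b = b1.
Proof.
move=> oA oB; have [//|[w1 _]] := odd_root oA.
have kA0 : 0 < kA by case: (kA) oA.
have [beta [c [t [ew _]]]] := torsion_lift kA0 w1; rewrite oB /= => ec.
pose e (c : bool) : int := if c then (-1)%R else 1%R.
have he : wteven e mB by move=> k ek; move: oB; rewrite /oddlab ek => ->.
have ek : kA = kA./2.*2.+1 by rewrite -[LHS]odd_double_half oA.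
have rel := hom_rel; rewrite ek in rel.
have eb := awt_altp_odd he rel.
have := congr1 (@awt e mB) ew; rewrite awt_conj // awt_zpow // awtM // eb.
have -> : awt e b1 = 1%R by rewrite awt_cl.
rewrite ec; have -> : awt e (fgen mB true) = 0%R by rewrite awtM // !awt_cl.
by rewrite mul0r.

Qed.

(** [w] has length 2, which excludes conjugates of powers of $\Delta_B$ and leaves a conjugate of
    $u_B$ itself. By [involution_conj] the conjugator is $b_1^k u^i$ in the quotient, so $w$ becomes
    $b_1^k u b_1^{-k}$; lengths lift the resulting formula for [b]. *)
Lemma hom_odd_odd kB : mB = Some kB -> odd kA -> odd kB ->
  b = b1 \/ kB %| kA /\ exists t, b = zpow b1 t * cl mB x2 * zpow b1 (- t)%R.
Proof.
move=> eB oA oB; have [|[w1 inv]] := odd_root oA; [by left|right].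
have om : oddlab mB by rewrite /oddlab eB.
have lB : lab mB = kB by rewrite /lab eB.
have kA0 : 0 < kA by case: (kA) oA.
have ekA : kA = kA./2.*2.+1 by rewrite -[LHS]odd_double_half oA.
have ekB : kB = kB./2.*2.+1 by rewrite -[LHS]odd_double_half oB.
have rel := hom_rel; rewrite ekA in rel.
have he := @length_even mB.
have lenb : awt (fun=> 1%R) b = 1%R by rewrite (awt_altp_odd he rel) len_x1.
have lenw : awt (fun=> 1%R) w = 2%R by rewrite awtM // lenb len_x1.
have [beta [c [t [ew dvd _]]]] := torsion_lift kA0 w1.
have := congr1 (@awt (fun=> 1%R) mB) ew; rewrite awt_conj // awt_zpow // lenw.
case: c => [|] in ew dvd *; last first.
  (* The length of $\Delta_B$ is read off $\Delta_B^2 = u_B^{k_B}$; a multiple of it equal to 2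
     would make the odd number [kB] divide 2. *)
  have := congr1 (@awt (fun=> 1%R) mB) (zgen_true mB).
  rewrite {1}(zgen_false om) /fpord om lB !awtX // len_u.
  set a := awt _ _ => ea; have {ea}-> : a = kB%:Z%R.
    by move: ea; rewrite -(mulr_natr a) -(mulr_natr 2%R) !natz; lia.
  move/(congr1 absz); rewrite abszM /= => e2.
  have /dvdn_leq : kB %| 2 by apply/dvdnP; exists `|t|%N; rewrite mulnC -e2.
  have kB3 : 1 < kB by move: vB; rewrite eB.
  by move/(_ isT) => kB2; have e : kB = 2; [lia|move: oB; rewrite e].
rewrite len_u => t1; have {}t1 : t = 1%R by lia.
rewrite t1 mul1r /fpord om lB in dvd.
have {t1}ew : Phi w = Phi beta * syl (fpord mB) true 1 * (Phi beta)^-1.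
  by rewrite ew !PhiM PhiV Phi_zpow t1 Phi_fgen.
split=> //; set h := Phi beta in ew *.
have [p0 p1] : fpord mB false = 2 /\ fpord mB true = kB./2.*2.+1.
  by rewrite /fpord om lB -ekB.
have emdl : mdl1 mB = fpmk (fpord mB) [:: (true, kB./2.+1%:Z%R); (false, 1%R)].
  by rewrite /mdl1 om lB.
have kB0 : 0 < kB./2 by move: vB; rewrite eB /= half_gt0.
have [|k [i eh]] := @involution_conj (fpord mB) kB./2 p0 p1 kB0 h.
  rewrite -emdl -inv ew; congr ((_ * _) ^+ 2).
  rewrite -[RHS]/(zpow _ (Posz _)) zpow_conj zpow_syl mul1r; congr (_ * _ * _).
  apply: eq_syl; rewrite p1 -ekB; apply/eqP; rewrite eqz_mod_dvd.
  case/dvdnP: dvd => q; rewrite /= => eq.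
  have oq : odd q by move: oA; rewrite eq oddM => /andP[].
  (* With [kA = q * kB] and [q] odd, [kA./2 = q./2 * kB + kB./2]. *)
  apply/dvdzP; exists (- q./2%:Z)%R.
  have hq := odd_double_half q; rewrite oq in hq.
  have e1 : kA = (q./2 * kB).*2 + kB.
    by rewrite eq -{1}hq mulnDl mul1n addnC -muln2 -mulnA (mulnC 2) mulnA muln2.
  by rewrite mulNr -PoszM; lia.
rewrite -emdl in eh.
exists k; apply: Phi_len_inj; last first.
  by rewrite !awtM // !awt_zpow // lenb len_x1 len_x2; lia.
have -> : Phi b = (mdl1 mB)^-1 * Phi w by rewrite -Phi_x1 -PhiV -PhiM -bE.
rewrite ew eh !PhiM !Phi_zpow Phi_x1 Phi_x2 zpowN.
have cu : syl (fpord mB) true i * syl (fpord mB) true 1 =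
    syl (fpord mB) true 1 * syl (fpord mB) true i.
  by rewrite -!sylD addrC.
have ck : (mdl1 mB)^-1 * zpow (mdl1 mB) k = zpow (mdl1 mB) k * (mdl1 mB)^-1.
  by apply/commute_zpow/commute_sym/commuteV/commute_refl.
by rewrite invgM -(mulgA (zpow _ _)) cu !mulgA mulgK ck.
Qed.

Lemma hom_even : 0 < kA -> ~~ odd kA ->
  (exists t1 t2, b = zpow (zgen mB) t1 * zpow b1 t2) \/
  exists beta c t, [/\ b = b1^-1 * (beta * zpow (fgen mB c) t * beta^-1),
    (fpord mB c %| (t * kA./2%:Z)%R)%Z & oddlab mB || c].
Proof.
move=> kA0 oA; have [|w1] := even_root kA0 oA; [by left|right].
have [|beta [c [t [ew dvd oc]]]] := torsion_lift _ w1.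
  by have := odd_double_half kA; rewrite (negbTE oA); lia.
by exists beta, c, t; rewrite -ew mulKg.
Qed.

End Hom.

(** * Homomorphisms defined by substitution *)

Section Substitution.
Variables (mA mB : option nat) (v : word).

Definition substl (l : letter) : word :=
  let v' := if l.1 then v else x1 in if l.2 then winv v' else v'.
Definition substw (w : word) : word := flatten (map substl w).

Lemma cl_substw w :
  cl mB (substw w) = ev (fun b => if b then cl mB v else cl mB x1) w.
Proof.
elim: w => // l w IH; rewrite -[substw _]/(substl l ++ substw w) cl_cat IH /=.
by congr (_ * _); case: l => [[] []]; rewrite /substl /evl /= ?cl_winv.
Qed.

Lemma substw_hom :
  (forall k, mA = Some k ->
     altp (cl mB x1) (cl mB v) k = altp (cl mB v) (cl mB x1) k) ->
  exists f, is_hom mA mB f /\ weq mB (f x1) x1 /\ weq mB (f x2) v.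
Proof.
move=> rel; exists substw; split; [split|split].
- by move=> w w' e; apply/clP; rewrite !cl_substw; apply: ev_weq e.
- by move=> w w'; rewrite /substw map_cat flatten_cat; apply: weq_refl.
- exact: weq_refl.
- by rewrite /substw /= cats0; apply: weq_refl.
Qed.

End Substitution.

Lemma artin2_commute (v : word) : commute (cl (Some 2) x1) (cl (Some 2) v).
Proof.
set x := cl _ x1; have c2 : commute x (cl (Some 2) x2).
  by have := artin_rel (erefl (Some 2)); rewrite /= !mulg1.
elim: v => [|[b c] v IH]; first exact: commute1.
rewrite -cat1s cl_cat; apply: commuteM IH.
have h : commute x (cl (Some 2) [:: (b, false)]).
  by case: b => //; apply: commute_refl.
case: c => //.
have -> : cl (Some 2) [:: (b, true)] = (cl (Some 2) [:: (b, false)])^-1.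
  by rewrite -cl_winv.
exact: commuteV.
Qed.

(** * Case analysis on the two labels *)

Lemma zgen_infty m : m = None -> zgen m = 1.
Proof. by move->. Qed.

Lemma zgen_fin m k : m = Some k -> zgen m = cl m (deltaB k).
Proof. by move->. Qed.

(** After division by the gcd, [q] and [t] become coprime, and Gauss's lemma applies. *)
Lemma divn_gcdn_dvdn q t n : 0 < q -> q %| t * n -> q %/ gcdn t q %| n.
Proof.
move=> q0 h; have g0 : 0 < gcdn t q by rewrite gcdn_gt0 q0 orbT.
have [t' et] := dvdnP (dvdn_gcdl t q); have [q' eq] := dvdnP (dvdn_gcdr t q).
set g := gcdn t q in g0 et eq *.
have cop : coprime q' t'.
  by rewrite /coprime -(eqn_pmul2r g0) mul1n muln_gcdl -eq -et gcdnC.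
rewrite eq mulnK //; rewrite -(Gauss_dvdr _ cop).
by move: h; rewrite eq et mulnAC dvdn_pmul2r.
Qed.

Theorem theorem2p1 (mA mB : option nat) (hA : valid_label mA) (hB : valid_label mB) :
  (* (1) *)
  (mA = None -> forall x : word, exists f, is_hom mA mB f /\
      weq mB (f x1) x1 /\ weq mB (f x2) x) /\
  (* (2) *)
  (forall kA, mA = Some kA -> odd kA ->
     (mB = None \/ exists kB, mB = Some kB /\ ~~ odd kB) ->
     forall f, is_hom mA mB f -> weq mB (f x1) x1 -> weq mB (f x2) x1) /\
  (* (3) *)
  (forall kA kB, mA = Some kA -> mB = Some kB -> odd kA -> odd kB ->
     forall f, is_hom mA mB f -> weq mB (f x1) x1 ->
       weq mB (f x2) x1 \/
       ((kB %| kA)%N /\ exists t : int,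
           weq mB (f x2) (wpow x1 t ++ x2 ++ wpow x1 (- t)%R))) /\
  (* (4) *)
  (forall kA, mA = Some kA -> ~~ odd kA -> mB = None ->
     forall f, is_hom mA mB f -> weq mB (f x1) x1 ->
       exists t : int, weq mB (f x2) (wpow x1 t)) /\
  (* (5) *)
  (forall kA kB, mA = Some kA -> mB = Some kB -> ~~ odd kA -> odd kB ->
     forall f, is_hom mA mB f -> weq mB (f x1) x1 ->
       (exists t1 t2 : int, weq mB (f x2) (wpow (deltaB kB) t1 ++ wpow x1 t2)) \/
       ((4 %| kA)%N /\ exists (beta : word) (t : int),
           weq mB (f x2) (winv x1 ++ beta ++ wpow (Garside kB) t ++ winv beta)) \/
       (exists (beta : word) (t : int),
           weq mB (f x2) (winv x1 ++ beta ++ wpow uB t ++ winv beta) /\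
           let p := gcdn (absz t) kB in
           let q := (kB %/ p)%N in
           (q %| kA %/ 2)%N)) /\
  (* (6) *)
  (forall kA kB, mA = Some kA -> mB = Some kB -> ~~ odd kA -> ~~ odd kB -> kB <> 2%N ->
     forall f, is_hom mA mB f -> weq mB (f x1) x1 ->
       (exists t1 t2 : int, weq mB (f x2) (wpow (deltaB kB) t1 ++ wpow x1 t2)) \/
       (exists (beta : word) (t : int),
           weq mB (f x2) (winv x1 ++ beta ++ wpow uB t ++ winv beta) /\
           let p := gcdn (absz t) (kB %/ 2) in
           let q := (kB %/ (2 * p))%N in
           (q %| kA %/ 2)%N)) /\
  (* (7) *)
  (forall kA, mA = Some kA -> ~~ odd kA -> mB = Some 2%N ->
     forall x : word, exists f, is_hom mA mB f /\
       weq mB (f x1) x1 /\ weq mB (f x2) x).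
Proof.
split; [|split; [|split; [|split; [|split; [|split]]]]].
- by move=> eA v; apply: substw_hom => k; rewrite eA.
- move=> kA eA oA eB f; rewrite eA => hf f1; apply/clP.
  apply: (hom_odd_even hB hf f1 oA); rewrite /oddlab.
  by case: eB => [->|[kB [-> /negbTE]]].
- move=> kA kB eA eB oA oB f; rewrite eA => hf f1.
  have [e|[dv [t e]]] := hom_odd_odd hB hf f1 eB oA oB; first by left; apply/clP.
  right; split=> //; exists t; apply/clP.
  by rewrite e !cl_cat !cl_wpow mulgA.
- move=> kA eA oA eB f; rewrite eA => hf f1.
  have kA0 : 0 < kA by move: hA; rewrite eA /=; lia.
  have [[t1 [t2 e]]|[beta [c [t [e dv oc]]]]] := hom_even hB hf f1 kA0 oA.
    exists t2; apply/clP; rewrite e cl_wpow.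
    by rewrite zgen_infty //; case: t1 {e} => n; rewrite /= ?invg1 expg1n mul1g.
  (* Both factors are infinite, so the torsion element is trivial and $\varphi(a_2) = b_1^{-1}$. *)
  exists (-1)%R; apply/clP; rewrite e cl_wpow (zpowN _ 1).
  have -> : t = 0%R.
    have p0 : fpord mB c = 0 by rewrite /fpord /oddlab /lab eB; case: (c).
    move: dv; rewrite p0 dvd0z mulf_eq0.
    by have := odd_double_half kA; rewrite (negbTE oA); lia.
  by rewrite mulg1 mulgV mulg1.
- move=> kA kB eA eB oA oB f; rewrite eA => hf f1.
  have kA0 : 0 < kA by move: hA; rewrite eA /=; lia.
  have kB0 : 0 < kB by case: (kB) oB.
  have om : oddlab mB by rewrite /oddlab eB.
  have lB : lab mB = kB by rewrite /lab eB.
  have ekA := odd_double_half kA; rewrite (negbTE oA) add0n in ekA.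
  have [[t1 [t2 e]]|[beta [c [t [e dv _]]]]] := hom_even hB hf f1 kA0 oA.
    left; exists t1, t2; apply/clP; rewrite e cl_cat !cl_wpow.
    by rewrite (zgen_fin eB).
  right; have key (beta' : artin mB) t' :
      cl mB (f x2) = (cl mB x1)^-1 * (beta' * zpow (fgen mB true) t' * beta'^-1) ->
      (kB %| (t' * kA./2%:Z)%R)%Z ->
      exists (beta : word) (t : int),
         weq mB (f x2) (winv x1 ++ beta ++ wpow uB t ++ winv beta) /\
         let p := gcdn (absz t) kB in
         let q := (kB %/ p)%N in
         (q %| kA %/ 2)%N.
    move=> e' dv'; exists (repr beta'), t'; split.
      apply/clP; rewrite e' !cl_cat !cl_winv cl_repr cl_wpow cl_uB.
      by rewrite !mulgA.
    rewrite /= divn2; apply: divn_gcdn_dvdn => //.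
    by move: dv'; rewrite dvdzE abszM.
  case: c e dv => e; rewrite /fpord om ?lB => dv; first by right; apply: key e dv.
  have [ev4|nev] := boolP (2 %| kA./2).
    left; split.
      by case/dvdnP: ev4 => q eq; rewrite -ekA eq; apply/dvdnP; exists q; lia.
    exists (repr beta), t; apply/clP.
    rewrite e !cl_cat !cl_winv cl_repr cl_wpow /fgen om lB.
    by rewrite !mulgA.
  (* When [kA./2] is odd, 2 divides [t], and $\Delta_B^{2t'} = u_B^{k_B t'}$ moves this case to the
     alternative with powers of $u_B$. *)
  right; have /dvdzP[t' et] : (2 %| t)%Z.
    move: dv; rewrite !dvdzE abszM /= Euclid_dvdM // (negbTE nev) orbF.
    by [].
  apply: (key beta (kB%:Z * t')%R).
    rewrite e et mulrC !zpowM.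
    have := zgen_false om; have := zgen_true mB; rewrite /fpord om lB /= => <-.
    by rewrite expg2 => <-.
  by rewrite -mulrA dvdz_mulr.
- move=> kA kB eA eB oA oB _ f; rewrite eA => hf f1.
  have kA0 : 0 < kA by move: hA; rewrite eA /=; lia.
  have kB0 : 1 < kB by move: hB; rewrite eB.
  have om : oddlab mB = false by rewrite /oddlab eB; apply/negbTE.
  have lB : lab mB = kB by rewrite /lab eB.
  have [[t1 [t2 e]]|[beta [c [t [e dv oc]]]]] := hom_even hB hf f1 kA0 oA.
    left; exists t1, t2; apply/clP; rewrite e cl_cat !cl_wpow.
    by rewrite (zgen_fin eB).
  right; exists (repr beta), t; move: oc e dv; rewrite om orFb => -> e.
  rewrite /fpord om lB => dv; split.
    apply/clP; rewrite e !cl_cat !cl_winv cl_repr cl_wpow cl_uB.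
    by rewrite !mulgA.
  rewrite /= divnMA !divn2; apply: divn_gcdn_dvdn; first by rewrite half_gt0.
  by move: dv; rewrite dvdzE abszM.
move=> kA eA oA eB v; rewrite eB; apply: substw_hom => k; rewrite eA => -[<-].
have <- : kA./2.*2 = kA by rewrite -[RHS]odd_double_half (negbTE oA).
exact/commute_exp_double/artin2_commute.
Qed.
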